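(* For every cap body $K\subset\mathbb{R}^3$ there exist a regular tetrahedron inscribed in the unit sphere $\mathbb{S}^2$, with vertex set $L\subset\mathbb{S}^2$, and two directions $v,w\in\mathbb{S}^2$ such that the set of directions $L\cup\{v,w\}$ illuminates $K$.
   Context: Let $\mathbb{B}^3=\{x\in\mathbb{R}^3:\|x\|\le 1\}$ be the closed Euclidean unit ball centred at the origin, $\mathbb{S}^2$ its boundary sphere, and let $\mathrm{conv}(\cdot)$ denote the closed convex hull. A set $K\subset\mathbb{R}^3$ is a cap body if $K=\mathrm{conv}(\mathbb{B}^3\cup\{x_1,\dots,x_m\})$ for some finite set of distinct points $x_1,\dots,x_m\in\mathbb{R}^3\setminus\mathbb{B}^3$ (the vertices) such that for all $1\le i<j\le m$ the closed segment joining $x_i$ and $x_j$ intersects $\mathbb{B}^3$. A direction is a unit vector in $\mathbb{R}^3$. For a convex body $K$ (convex compact set with non-empty interior), a direction $v$ illuminates a point $x\in\partial K$ if the ray $\{x+tv: t\ge 0\}$ has nonempty intersection with the interior of $K$. A set of directions illuminates $K$ if every point of $\partial K$ is illuminated by some direction in the set. *)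

(* Defs.v *)
From HB Require Import structures.
From mathcomp Require Import all_boot all_order all_algebra.
From mathcomp Require Import all_classical all_reals all_analysis.

Set Implicit Arguments.
Unset Strict Implicit.
Unset Printing Implicit Defensive.

Import Order.TTheory GRing.Theory Num.Theory.
Import numFieldNormedType.Exports.

Local Open Scope classical_set_scope.
Local Open Scope ring_scope.

(* R^n is 'rV[R]_n.  The library norm on 'rV[R]_n is the sup norm, so the
   Euclidean norm is defined separately; the library topology is the product
   topology, which is the Euclidean one. *)
Definition enorm (R : realType) (n : nat) (x : 'rV[R]_n) : R :=
  Num.sqrt (\sum_(i < n) x 0 i ^+ 2).

Definition unit_ball (R : realType) (n : nat) : set 'rV[R]_n :=
  [set x | enorm x <= 1].

Definition unit_sphere (R : realType) (n : nat) : set 'rV[R]_n :=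
  [set x | enorm x = 1].

Definition segment (R : realType) (n : nat) (p q : 'rV[R]_n) : set 'rV[R]_n :=
  [set (1 - t) *: p + t *: q | t in `[0, 1]].

Definition ray (R : realType) (n : nat) (p v : 'rV[R]_n) : set 'rV[R]_n :=
  [set p + t *: v | t in `[0, +oo[].

Definition closed_convex_hull (R : realType) (n : nat) (A : set 'rV[R]_n) :
    set 'rV[R]_n :=
  smallest [set C : set 'rV[R]_n | closed C /\ convex_set C] A.

(* m = 0 is allowed: the unit ball is a cap body without vertices. *)
Definition cap_body (R : realType) (n : nat) (K : set 'rV[R]_n) : Prop :=
  exists (m : nat) (x : 'I_m -> 'rV[R]_n),
    [/\ injective x,
        forall i, ~ @unit_ball R n (x i),
        forall i j : 'I_m, (i < j)%N ->
          segment (x i) (x j) `&` @unit_ball R n !=set0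
      & K = closed_convex_hull (@unit_ball R n `|` range x)].

Definition boundary (R : realType) (n : nat) (A : set 'rV[R]_n) :
    set 'rV[R]_n :=
  closure A `\` interior A.

Definition illuminates_point (R : realType) (n : nat) (K : set 'rV[R]_n)
    (v x : 'rV[R]_n) : Prop :=
  ray x v `&` interior K !=set0.

Definition illuminates (R : realType) (n : nat) (D K : set 'rV[R]_n) : Prop :=
  forall x, boundary K x -> exists2 v, D v & illuminates_point K v x.

(* L is the vertex set of a regular tetrahedron inscribed in the unit sphere:
   four points of the sphere, all six edges having the same length d > 0.
   Such points are automatically distinct and affinely independent. *)
Definition inscribed_regular_tetrahedron (R : realType) (L : set 'rV[R]_3) :
    Prop :=
  exists (a : 'I_4 -> 'rV[R]_3) (d : R),
    [/\ L = range a,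
        forall i, @unit_sphere R 3 (a i),
        0 < d
      & forall i j : 'I_4, (i < j)%N -> enorm (a i - a j) = d].

(* Main.v *)
Require Import Defs.
From HB Require Import structures.
From mathcomp Require Import all_boot all_order all_algebra.
From mathcomp Require Import all_classical all_reals all_analysis.
From mathcomp Require Import measurable_realfun ring lra.


(** With [p] and [u] unit vectors, the direction [-p] illuminates the vertex
[x = u / cos phi] iff [p . u > sin phi],
and the six directions illuminate [K] as soon as they illuminate its vertices
and the sphere.  Rotate a regular tetrahedron at random.  Each of its vertices
[z] is uniform on the sphere, so by Archimedes [P (z . u > c) = (1 - c) / 2].
Hence the probability that the four directions miss a given vertex of [K] is at
most three times the area fraction [(1 - cos phi) / 2] of its cap; for wide caps
this reads [2 sin phi + (3/2) cos phi <= 5/2].  The caps are disjoint, so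
the expected number of missed vertices is less than 3 (if all inequalities are
equalities then [sin phi = 4/5] for all caps, and there are at most 4 of them),
and some rotation misses at most two, which the two extra directions take care
of.

Random rotations are given by quaternions [q] uniform in the unit ball of
[R^4 = R^2 x R^2]: multiplication by a unit quaternion is a product of block
shears, so it preserves Lebesgue measure, which reduces Archimedes' theorem to
the volume of [{(a, b) : |a|^2 - |b|^2 > c (|a|^2 + |b|^2)}] in the ball. *)

Set Implicit Arguments.
Unset Strict Implicit.
Unset Printing Implicit Defensive.

Import Order.TTheory GRing.Theory Num.Theory.
Import numFieldNormedType.Exports.

Local Open Scope classical_set_scope.
Local Open Scope ring_scope.

(** * Maps scaling a measure *)

Section scaling_maps.
Context (R : realType).
Local Open Scope ereal_scope.

(** Preimages rather than images, so that no inverse map is needed: an invertible linear map scales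
    with the inverse of the absolute value of its determinant. *)
Definition scales_measure d (T : measurableType d)
    (m : {measure set T -> \bar R}) (k : R) (f : T -> T) :=
  [/\ (0 < k)%R, measurable_fun setT f &
      forall A, measurable A -> m (f @^-1` A) = k%:E * m A].

Lemma scales_measure_comp d (T : measurableType d)
    (m : {measure set T -> \bar R}) k l f g :
  scales_measure m k f -> scales_measure m l g ->
  scales_measure m (k * l)%R (f \o g).
Proof.
move=> [k0 mf fE] [l0 mg gE]; split; first exact: mulr_gt0.
- exact: measurableT_comp.
- move=> A mA; rewrite comp_preimage gE ?fE//; last first.
    by rewrite -[X in measurable X]setTI; exact: mf.
  by rewrite muleA EFinM [(_ * l%:E)]muleC.
Qed.

(** The pushforward of the product measure, divided by [k * l], agrees with it on rectangles, and
    rectangles determine it. *)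
Lemma scales_measure_prod d1 d2 (T1 : measurableType d1)
    (T2 : measurableType d2) (m1 : {sigma_finite_measure set T1 -> \bar R})
    (m2 : {sigma_finite_measure set T2 -> \bar R}) k l f g :
  scales_measure m1 k f -> scales_measure m2 l g ->
  scales_measure (m1 \x m2) (k * l)%R (fun x => (f x.1, g x.2)).
Proof.
move=> [k0 mf fE] [l0 mg gE].
have mfg : measurable_fun setT (fun x : T1 * T2 => (f x.1, g x.2)).
  by apply: measurable_fun_pair => //=; exact: measurableT_comp.
split=> //; first exact: mulr_gt0.
move=> A mA.
have kl0 : (0 < k * l)%R by exact: mulr_gt0.
have kl1 : (0 <= (k * l)^-1)%R by rewrite invr_ge0 ltW.
pose fg : {mfun (T1 * T2)%type >-> (T1 * T2)%type} :=
  HB.pack (fun x : T1 * T2 => (f x.1, g x.2))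
    (isMeasurableFun.Build _ _ _ _ _ mfg).
change ((m1 \x m2) ((fun x => (f x.1, g x.2)) @^-1` A) =
  (k * l)%:E * (m1 \x m2) A).
have -> : (m1 \x m2) A = ((k * l)^-1)%:E * (m1 \x m2) ((fun x => (f x.1, g x.2)) @^-1` A).
  apply: (@product_measure_unique _ _ _ _ R m1 m2
    (mscale (NngNum kl1) (pushforward (m1 \x m2) fg))) => //.
  move=> X Y mX mY; rewrite /= /mscale/= /pushforward.
  rewrite (_ : _ @^-1` _ = (f @^-1` X) `*` (g @^-1` Y)); last first.
    by apply/seteqP; split => -[].
  rewrite product_measure1E; last 2 first.
    - by rewrite -[X in measurable X]setTI; exact: mf.
    - by rewrite -[X in measurable X]setTI; exact: mg.
  rewrite fE// gE//.
  have kl (x y : \bar R) : ((k * l)^-1)%:E * (k%:E * x * (l%:E * y)) = x * y.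
    rewrite (muleACA k%:E) -(EFinM k) (muleA ((k * l)^-1)%:E) -EFinM.
    by rewrite mulVf ?gt_eqF// mul1e.
  exact: kl.
by rewrite muleA -EFinM divff ?gt_eqF// mul1e.
Qed.

Lemma lebesgue_translation (a : R) :
  scales_measure (@lebesgue_measure R) 1 (fun x : measurableTypeR R => (x + a)%R).
Proof.
have mf : measurable_fun setT
   (fun x : measurableTypeR R => (x + a)%R : measurableTypeR R).
  exact: measurable_funD.
split=> // A mA.
pose f : {mfun measurableTypeR R >-> measurableTypeR R} :=
  HB.pack (fun x : measurableTypeR R => (x + a)%R : measurableTypeR R)
    (isMeasurableFun.Build _ _ _ _ _ mf).
rewrite mul1e.
apply/esym/(@lebesgue_measure_unique _ (pushforward lebesgue_measure f)) => //= _ [[x y]] _ <-.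
rewrite /pushforward.
rewrite (_ : _ @^-1` _ = `](x - a)%R, (y - a)%R]%classic); last first.
  by apply/seteqP; split => z /=; rewrite !in_itv/= ltrBlDr lerBrDr.
rewrite !lebesgue_measure_itv/= !lte_fin ltrD2r -!EFinD.
by congr (if _ then _%:E else _); ring.
Qed.

Lemma lebesgue_dilation (r : R) : (0 < r)%R ->
  scales_measure (@lebesgue_measure R) r^-1 (fun x : measurableTypeR R => (r * x)%R).
Proof.
move=> r0.
have mf : measurable_fun setT
   (fun x : measurableTypeR R => (r * x)%R : measurableTypeR R).
  exact: measurable_funM.
split=> //; first by rewrite invr_gt0.
move=> A mA.
pose f : {mfun measurableTypeR R >-> measurableTypeR R} :=
  HB.pack (fun x : measurableTypeR R => (r * x)%R : measurableTypeR R)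
    (isMeasurableFun.Build _ _ _ _ _ mf).
have r0' := ltW r0.
change (lebesgue_measure (f @^-1` A) = r^-1%:E * lebesgue_measure A).
have -> : lebesgue_measure A = r%:E * lebesgue_measure (f @^-1` A).
  apply: (@lebesgue_measure_unique _ (mscale (NngNum r0') (pushforward lebesgue_measure f))) => //.
  move=> _ [[x y]] _ <-.
  change (lebesgue_measure `]x, y]%classic =
    r%:E * lebesgue_measure (f @^-1` `]x, y]%classic)).
  rewrite (_ : _ @^-1` _ = `](x / r)%R, (y / r)%R]%classic); last first.
    apply/seteqP; split => z /=; rewrite !in_itv/=.
      by rewrite ltr_pdivrMr// ler_pdivlMr// (mulrC z).
    by rewrite ltr_pdivrMr// ler_pdivlMr// (mulrC z).
  rewrite !lebesgue_measure_itv/= !lte_fin ltr_pM2r ?invr_gt0//.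
  case: ifP => _; last by rewrite mule0.
  by rewrite -!EFinD -EFinM -mulrBl mulrCA divff ?gt_eqF// mulr1.
by rewrite muleA -EFinM mulVf ?gt_eqF// mul1e.
Qed.

(** Cavalieri: over each [x] the section of the preimage is the preimage of the section under [f x],
    which has the same measure. *)
Lemma scales_measure_shear d1 d2 (T1 : measurableType d1)
    (T2 : measurableType d2) (m1 : {sigma_finite_measure set T1 -> \bar R})
    (m2 : {sigma_finite_measure set T2 -> \bar R}) (f : T1 -> T2 -> T2) :
  measurable_fun setT (fun x : T1 * T2 => f x.1 x.2) ->
  (forall x, scales_measure m2 1 (f x)) ->
  scales_measure (m1 \x m2) 1 (fun x => (x.1, f x.1 x.2)).
Proof.
move=> mf fE; have mF : measurable_fun setT (fun x : T1 * T2 => (x.1, f x.1 x.2)).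
  exact: measurable_fun_pair.
split=> // A mA; rewrite mul1e /product_measure1.
apply: eq_integral => x _ /=.
have [_ _ /(_ (xsection A x))] := fE x.
rewrite mul1e => <-; last exact: measurable_xsection.
by congr (m2 _); apply/seteqP; split => y /=; rewrite /xsection/= !inE.
Qed.

Lemma scales_measure_swap d1 (T1 : measurableType d1)
    (m1 : {sigma_finite_measure set T1 -> \bar R}) :
  scales_measure (m1 \x m1) 1 (fun x => (x.2, x.1)).
Proof.
have mf : measurable_fun setT (fun x : T1 * T1 => (x.2, x.1)).
  by apply: measurable_fun_pair.
split=> // A mA; rewrite mul1e.
pose f : {mfun (T1 * T1)%type >-> (T1 * T1)%type} :=
  HB.pack (fun x : T1 * T1 => (x.2, x.1))
    (isMeasurableFun.Build _ _ _ _ _ mf).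
apply/esym/(@product_measure_unique _ _ _ _ R m1 m1
   (pushforward (m1 \x m1) f)) => // X Y mX mY.
rewrite /= /pushforward (_ : _ @^-1` _ = Y `*` X); last first.
  by apply/seteqP; split => -[x y] /= [].
by rewrite product_measure1E// muleC.
Qed.

End scaling_maps.

(** * A value below the average *)

Section averaging.
Context (R : realType) d (T : measurableType d) (mu : {measure set T -> \bar R}).
Variable D : set T.
Hypotheses (mD : measurable D) (Dfin : (mu D < +oo)%E).

Lemma integrable_scaled_indic (w : R) (A : set T) : measurable A ->
  mu.-integrable D (fun x => w%:E * (\1_A x)%:E)%E.
Proof.
move=> mA; apply: integrableZl => //; apply/integrableP; split.
  by apply/measurable_EFinP; exact: measurable_indic.
rewrite (eq_integral (fun x => (\1_A x)%:E)); last first.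
  by move=> x _; rewrite gee0_abs// lee_fin.
rewrite integral_indic//; apply: le_lt_trans Dfin.
by apply: le_measure; rewrite ?inE//; exact: measurableI.
Qed.

(** If the weighted count were at least [w0] throughout [D], integrating it would contradict the
    hypothesis. The weights may be negative, so the argument goes through integrability. *)
Lemma exists_below_average (J : finType) (w : J -> R) (A : J -> set T) (w0 : R) :
  (forall j, measurable (A j)) ->
  (\sum_j (w j)%:E * mu (A j `&` D) < w0%:E * mu D)%E ->
  exists2 x, D x & \sum_j w j * \1_(A j) x < w0.
Proof.
move=> mA; apply: contraPP => /forall2NP H; apply/negP; rewrite -leNgt.
have E : (\int[mu]_(x in D) (\sum_j (w j)%:E * (\1_(A j) x)%:E) =
          \sum_j (w j)%:E * mu (A j `&` D))%E.
  rewrite integral_sum//; last by move=> j; exact: integrable_scaled_indic.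
  apply: eq_bigr => j _.
  have := integrable_scaled_indic 1 (mA j).
  under eq_fun do rewrite mul1e.
  by move=> Aint; rewrite integralZl// integral_indic.
rewrite -E -integral_cst//; apply: le_integral => //.
- have := integrable_scaled_indic w0 measurableT.
  by under eq_fun do rewrite indicT mule1.
- by apply: (integrable_sum mD) => j _; exact: integrable_scaled_indic.
- move=> x; rewrite inE => Dx; have [//|/negP] := H x; rewrite -leNgt => w0x.
  by rewrite -(eq_bigr _ (fun j _ => EFinM _ _)) sumEFin lee_fin.
Qed.

End averaging.

(** * Lebesgue measure on the space of quaternions *)

Section plane_and_quaternions.
Context (R : realType).
Local Notation M := (measurableTypeR R).
Local Notation plane := (M * M)%type.
Local Notation quat := (plane * plane)%type.

Definition area : set plane -> \bar R :=
  (@lebesgue_measure R \x @lebesgue_measure R)%E.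
HB.instance Definition _ := Measure.on area.

Let area_sigma_finite : sigma_finite setT area.
Proof.
pose I (n : nat) : set M := `[- n%:R, n%:R]%classic.
exists (fun n => I n `*` I n).
  apply/seteqP; split=> // -[x y] _.
  exists (Num.bound (`|x| + `|y|)) => //.
  have := archi_boundP (addr_ge0 (normr_ge0 x) (normr_ge0 y)).
  set b := (Num.bound _)%:R => /ltW xyb.
  by split; rewrite /I /= in_itv/= -ler_norml (le_trans _ xyb)// (lerDl, lerDr).
move=> n; split; first by apply: measurableX; exact: measurable_itv.
rewrite /area product_measure1E; [|exact: measurable_itv..].
rewrite /I /= lebesgue_measure_itv/=; case: ifP => _; last by rewrite mule0 ltry.
by rewrite -EFinD -EFinM ltry.
Qed.

HB.instance Definition _ := Measure_isSigmaFinite.Build _ _ _ area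
  area_sigma_finite.

(** The grouping R^2 x R^2 suits both block shears and the quadratic form |a|^2 - |b|^2. *)
Definition vol4 : set quat -> \bar R := (area \x area)%E.
HB.instance Definition _ := Measure.on vol4.

Definition linear_plane (a b c d : R) (x : plane) : plane :=
  (a * x.1 + b * x.2, c * x.1 + d * x.2).

Lemma measurable_linear_plane a b c d :
  measurable_fun setT (linear_plane a b c d).
Proof.
by apply: measurable_fun_pair => /=; apply: measurable_funD;
  apply: measurable_funM.
Qed.

Lemma area_translation (a : plane) :
  scales_measure area 1 (fun x => (x.1 + a.1, x.2 + a.2)).
Proof.
rewrite -(mulr1 1).
exact: (scales_measure_prod (lebesgue_translation a.1) (lebesgue_translation a.2)).
Qed.

Lemma area_dilation (r : R) : 0 < r ->
  scales_measure area (r^-1 * r^-1) (fun x => (r * x.1, r * x.2)).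
Proof.
by move=> r0; exact: (scales_measure_prod (lebesgue_dilation r0) (lebesgue_dilation r0)).
Qed.

Definition lower_shear (a b c d : R) (q : quat) : quat :=
  (q.1, (q.2.1 + (linear_plane a b c d q.1).1, q.2.2 + (linear_plane a b c d q.1).2)).

Definition upper_shear (a b c d : R) (q : quat) : quat :=
  ((q.1.1 + (linear_plane a b c d q.2).1, q.1.2 + (linear_plane a b c d q.2).2), q.2).

Lemma vol4_lower_shear a b c d : scales_measure vol4 1 (lower_shear a b c d).
Proof.
pose f (x y : plane) : plane :=
  (y.1 + (linear_plane a b c d x).1, y.2 + (linear_plane a b c d x).2).
apply: (@scales_measure_shear _ _ _ _ _ area area f) => [|x]; last first.
  exact: area_translation.
have ml : measurable_fun setT (fun x : quat => linear_plane a b c d x.1).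
  by apply: measurableT_comp => //; exact: measurable_linear_plane.
apply: measurable_fun_pair; apply: measurable_funD.
- by apply: measurableT_comp.
- by apply: (measurableT_comp _ ml).
- by apply: measurableT_comp.
- by apply: (measurableT_comp _ ml).
Qed.

Lemma vol4_upper_shear a b c d : scales_measure vol4 1 (upper_shear a b c d).
Proof.
rewrite -(mulr1 1) -[X in X * _](mulr1 1).
have swap := scales_measure_swap area.
exact: (scales_measure_comp (scales_measure_comp swap (vol4_lower_shear a b c d)) swap).
Qed.

Definition normsq (q : quat) : R :=
  (q.1.1 ^+ 2 + q.1.2 ^+ 2) + (q.2.1 ^+ 2 + q.2.2 ^+ 2).

(* [rotdot q t u] is the scalar product of [q t q^*] and [u], where vectors of
   R^3 are read as pure quaternions; it equals [normsq q] times the scalar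
   product of [u] with a rotation of [t]. *)
Definition rotdot (q : quat) (t u : 'rV[R]_3) : R :=
  let a := q.1.1 in let b := q.1.2 in let c := q.2.1 in let d := q.2.2 in
    u 0 0 * ((a ^+ 2 + b ^+ 2 - c ^+ 2 - d ^+ 2) * t 0 0
      + 2 * (b * c - a * d) * t 0 1 + 2 * (b * d + a * c) * t 0 2)
  + u 0 1 * (2 * (b * c + a * d) * t 0 0
      + (a ^+ 2 - b ^+ 2 + c ^+ 2 - d ^+ 2) * t 0 1 + 2 * (c * d - a * b) * t 0 2)
  + u 0 2 * (2 * (b * d - a * c) * t 0 0 + 2 * (c * d + a * b) * t 0 1
      + (a ^+ 2 - b ^+ 2 - c ^+ 2 + d ^+ 2) * t 0 2).

(** The quaternion product h q with h = h1 i + h2 j + h3 k. *)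
Definition mul_pure_quat (h1 h2 h3 : R) (q : quat) : quat :=
  ((- h1 * q.1.2 - h2 * q.2.1 - h3 * q.2.2, h1 * q.1.1 + h2 * q.2.2 - h3 * q.2.1),
   (- h1 * q.2.2 + h2 * q.1.1 + h3 * q.1.2, h1 * q.2.1 - h2 * q.1.2 + h3 * q.1.1)).

Definition mul_quat_pure (k1 k2 k3 : R) (q : quat) : quat :=
  ((- q.1.2 * k1 - q.2.1 * k2 - q.2.2 * k3, q.1.1 * k1 + q.2.1 * k3 - q.2.2 * k2),
   (q.1.1 * k2 - q.1.2 * k3 + q.2.2 * k1, q.1.1 * k3 + q.1.2 * k2 - q.2.1 * k1)).

(* block LUL decomposition of the 4x4 matrix of the multiplication *)
Lemma vol4_mul_pure_quat h1 h2 h3 : h1 ^+ 2 + h2 ^+ 2 + h3 ^+ 2 = 1 ->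
  h2 ^+ 2 + h3 ^+ 2 != 0 -> scales_measure vol4 1 (mul_pure_quat h1 h2 h3).
Proof.
move=> h1E; set n := h2 ^+ 2 + h3 ^+ 2 => n0.
(* With A, B, C, D the 2x2 blocks of the matrix, read row by row, the middle factor carries C and
   the outer ones (A - 1) C^-1 and C^-1 (D - 1). The determinant of C is [- n]. *)
have -> : mul_pure_quat h1 h2 h3 =
    upper_shear ((- h2 - h1 * h3) / n) ((- h3 + h1 * h2) / n)
                ((h1 * h2 - h3) / n) ((h1 * h3 + h2) / n)
    \o (lower_shear h2 h3 h3 (- h2)
    \o upper_shear ((- h2 + h3 * h1) / n) ((- h2 * h1 - h3) / n)
                   ((- h3 - h2 * h1) / n) ((- h3 * h1 + h2) / n)).
  have nE : h1 ^+ 2 = 1 - n by rewrite /n -h1E; ring.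
  have h3E : h3 ^+ 2 = n - h2 ^+ 2 by rewrite /n; ring.
  apply/funext => -[[a b] [c d]].
  rewrite /mul_pure_quat /upper_shear /lower_shear /linear_plane /=.
  by congr ((_, _), (_, _)); field: nE h3E.
rewrite -(mulr1 1) -[X in _ * X](mulr1 1).
apply: scales_measure_comp; first exact: vol4_upper_shear.
by apply: scales_measure_comp; [exact: vol4_lower_shear|exact: vol4_upper_shear].
Qed.

(** Same factorization; here the lower left block has determinant [n]. *)
Lemma vol4_mul_quat_pure k1 k2 k3 : k1 ^+ 2 + k2 ^+ 2 + k3 ^+ 2 = 1 ->
  k2 ^+ 2 + k3 ^+ 2 != 0 -> scales_measure vol4 1 (mul_quat_pure k1 k2 k3).
Proof.
move=> k1E; set n := k2 ^+ 2 + k3 ^+ 2 => n0.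
have -> : mul_quat_pure k1 k2 k3 =
    upper_shear ((- k2 + k1 * k3) / n) ((- k3 - k1 * k2) / n)
                ((k1 * k2 + k3) / n) ((k1 * k3 - k2) / n)
    \o (lower_shear k2 (- k3) k3 k2
    \o upper_shear ((- k2 - k1 * k3) / n) ((k1 * k2 - k3) / n)
                   ((k3 - k1 * k2) / n) ((- k1 * k3 - k2) / n)).
  have nE : k1 ^+ 2 = 1 - n by rewrite /n -k1E; ring.
  have k3E : k3 ^+ 2 = n - k2 ^+ 2 by rewrite /n; ring.
  apply/funext => -[[a b] [c d]].
  rewrite /mul_quat_pure /upper_shear /lower_shear /linear_plane /=.
  by congr ((_, _), (_, _)); field: nE k3E.
rewrite -(mulr1 1) -[X in _ * X](mulr1 1).
apply: scales_measure_comp; first exact: vol4_upper_shear.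
by apply: scales_measure_comp; [exact: vol4_lower_shear|exact: vol4_upper_shear].
Qed.

Definition dot3 (x y : 'rV[R]_3) : R := x 0 0 * y 0 0 + x 0 1 * y 0 1 + x 0 2 * y 0 2.

Definition axis1 : 'rV[R]_3 := \row_j (j == 0)%:R.

Lemma dot3_axis1 : dot3 axis1 axis1 = 1.
Proof. by rewrite /dot3 !mxE /=; ring. Qed.

Lemma normsq_mul_pure_quat h1 h2 h3 q : h1 ^+ 2 + h2 ^+ 2 + h3 ^+ 2 = 1 ->
  normsq (mul_pure_quat h1 h2 h3 q) = normsq q.
Proof.
move=> h; rewrite -[RHS]mul1r -h /normsq /mul_pure_quat /=; ring.
Qed.

Lemma normsq_mul_quat_pure k1 k2 k3 q : k1 ^+ 2 + k2 ^+ 2 + k3 ^+ 2 = 1 ->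
  normsq (mul_quat_pure k1 k2 k3 q) = normsq q.
Proof.
move=> k; rewrite -[RHS]mul1r -k /normsq /mul_quat_pure /=; ring.
Qed.

(* The half-turn [x |-> 2 <h, x> h - x] exchanges [axis1] and [u]. *)
Definition half_turn_to (u : 'rV[R]_3) (h1 h2 h3 : R) :=
  [/\ h1 ^+ 2 + h2 ^+ 2 + h3 ^+ 2 = 1,
      [/\ u 0 0 = 2 * h1 * h1 - 1, u 0 1 = 2 * h1 * h2 & u 0 2 = 2 * h1 * h3]
    & h2 ^+ 2 + h3 ^+ 2 != 0].

(** Conjugation by the pure unit quaternion h is the half-turn about h. It is self-adjoint, so it
    can be moved to the other argument, where it sends [axis1] to [u]. *)
Lemma rotdot_mul_pure_quat (u : 'rV[R]_3) h1 h2 h3 q t : half_turn_to u h1 h2 h3 ->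
  rotdot (mul_pure_quat h1 h2 h3 q) t axis1 = rotdot q t u.
Proof.
move=> [h [u1 u2 u3] _].
have {}u1 : u 0 0 = h1 ^+ 2 - h2 ^+ 2 - h3 ^+ 2 by rewrite u1 -[X in _ - X]h; ring.
rewrite /rotdot u1 u2 u3 !mxE /=; ring.
Qed.

Lemma rotdot_mul_quat_pure (t : 'rV[R]_3) k1 k2 k3 q u : half_turn_to t k1 k2 k3 ->
  rotdot (mul_quat_pure k1 k2 k3 q) axis1 u = rotdot q t u.
Proof.
move=> [k [t1 t2 t3] _].
have {}t1 : t 0 0 = k1 ^+ 2 - k2 ^+ 2 - k3 ^+ 2 by rewrite t1 -[X in _ - X]k; ring.
rewrite /rotdot t1 t2 t3 !mxE /=; ring.
Qed.

(** The axis bisects [axis1] and [u]. For [u = axis1] it would be [axis1] itself, with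
    [h2 = h3 = 0], where the shear factorization breaks down. *)
Lemma half_turn_exists (u : 'rV[R]_3) : dot3 u u = 1 -> u <> axis1 ->
  exists h1 h2 h3, half_turn_to u h1 h2 h3.
Proof.
rewrite /dot3 => uu ue.
have [u1|u1] := eqVneq (u 0 0) (-1).
  have s0 : u 0 1 ^+ 2 + u 0 2 ^+ 2 = 0.
    by rewrite u1 in uu; rewrite !expr2; lra.
  have /eqP := s0; rewrite paddr_eq0 ?sqr_ge0// !sqrf_eq0 => /andP[/eqP u2 /eqP u3].
  (* Here [u] is opposite to [axis1], and any axis orthogonal to it will do. *)
  exists 0, 1, 0; split; [by ring| |by rewrite expr1n expr0n addr0 oner_eq0].
  by split; rewrite ?u1 ?u2 ?u3; ring.
have u1lt : -1 < u 0 0.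
  rewrite lt_neqAle eq_sym u1/=; nra.
(* This is the length of [axis1 + u], whose normalization is the axis. *)
pose n := Num.sqrt ((1 + u 0 0) * 2).
have n0 : 0 < n by rewrite sqrtr_gt0; nra.
have nn : n ^+ 2 = (1 + u 0 0) * 2 by rewrite sqr_sqrtr//; nra.
have nE : u 0 0 = n ^+ 2 / 2 - 1 by rewrite nn; field.
have n_neq0 : n != 0 by rewrite gt_eqF.
have u3E : u 0 2 ^+ 2 = 1 - u 0 0 ^+ 2 - u 0 1 ^+ 2.
  by rewrite !expr2 -uu; ring.
exists (n / 2), (u 0 1 / n), (u 0 2 / n); split.
- rewrite !exprMn exprVn u3E nE; field; exact: n_neq0.
- by split; rewrite ?nE; field; rewrite ?n_neq0.
- apply/negP; rewrite paddr_eq0 ?sqr_ge0// !sqrf_eq0 !mulf_eq0 invr_eq0.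
  rewrite (negbTE n_neq0) !orbF => /andP[/eqP u2 /eqP u3].
  apply: ue; apply/rowP => j; rewrite mxE.
  have u1E : u 0 0 = 1.
    by have /eqP := u3E; rewrite u2 u3; move=> /eqP; rewrite !expr2; nra.
  case: j => -[|[|[|//]]] lt /=.
  - by rewrite -[RHS]u1E; congr (u 0 _); exact/val_inj.
  - by rewrite -[RHS]u2; congr (u 0 _); exact/val_inj.
  - by rewrite -[RHS]u3; congr (u 0 _); exact/val_inj.
Qed.

Definition ball4 : set quat := [set q | normsq q <= 1].

(** The quaternions rotating [t] into the spherical cap of points y with y . u > c. Clearing the
    denominator [normsq q] keeps the condition polynomial and excludes q = 0. *)
Definition rotation_cap (t u : 'rV[R]_3) (c : R) : set quat :=
  [set q | normsq q <= 1 /\ c * normsq q < rotdot q t u].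

Let mcoord11 : measurable_fun setT (fun q : quat => q.1.1 : M).
Proof. exact: (measurableT_comp (f := @fst M M) (g := @fst plane plane)). Qed.
Let mcoord12 : measurable_fun setT (fun q : quat => q.1.2 : M).
Proof. exact: (measurableT_comp (f := @snd M M) (g := @fst plane plane)). Qed.
Let mcoord21 : measurable_fun setT (fun q : quat => q.2.1 : M).
Proof. exact: (measurableT_comp (f := @fst M M) (g := @snd plane plane)). Qed.
Let mcoord22 : measurable_fun setT (fun q : quat => q.2.2 : M).
Proof. exact: (measurableT_comp (f := @snd M M) (g := @snd plane plane)). Qed.

Lemma measurable_normsq : measurable_fun setT (normsq : quat -> M).
Proof.
by do 2 apply: measurable_funD;
  apply: measurable_funX.
Qed.

Lemma measurable_rotdot t u : measurable_fun setT (fun q => rotdot q t u : M).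
Proof.
rewrite /rotdot /=.
repeat lazymatch goal with
| |- measurable_fun _ (fun q => q.1.1) => exact: mcoord11
| |- measurable_fun _ (fun q => q.1.2) => exact: mcoord12
| |- measurable_fun _ (fun q => q.2.1) => exact: mcoord21
| |- measurable_fun _ (fun q => q.2.2) => exact: mcoord22
| |- measurable_fun _ (fun q => @?f q + @?g q) =>
    apply: (measurable_funD (f := f) (g := g))
| |- measurable_fun _ (fun q => - @?f q) =>
    apply: (measurable_funN (f := f))
| |- measurable_fun _ (fun q => @?f q * @?g q) =>
    apply: (measurable_funM (f := f) (g := g))
| |- measurable_fun _ (fun q => @?f q ^+ _) =>
    apply: (measurable_funX (f := f))
| |- _ => exact: measurable_cst
end.
Qed.

Lemma measurable_le_set d (T : measurableType d) (f g : T -> M) :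
  measurable_fun setT f -> measurable_fun setT g ->
  measurable [set x | f x <= g x].
Proof.
move=> mf mg.
by have := measurable_fun_ler mf mg measurableT (Y := [set true]); rewrite setTI; exact.
Qed.

Lemma measurable_lt_set d (T : measurableType d) (f g : T -> M) :
  measurable_fun setT f -> measurable_fun setT g ->
  measurable [set x | f x < g x].
Proof.
move=> mf mg.
by have := measurable_fun_ltr mf mg measurableT (Y := [set true]); rewrite setTI; exact.
Qed.

Lemma measurable_ball4 : measurable ball4.
Proof. by apply: measurable_le_set => //; exact: measurable_normsq. Qed.

Lemma measurable_rotation_cap t u c : measurable (rotation_cap t u c).
Proof.
apply: (measurableI _ _ measurable_ball4); apply: measurable_lt_set.
  by apply: measurable_funM => //; exact: measurable_normsq.
exact: measurable_rotdot.
Qed.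

Lemma scales_measure1 d (T : measurableType d)
    (m : {measure set T -> \bar R}) f A B :
  scales_measure m 1 f -> measurable A -> B = f @^-1` A -> m B = m A.
Proof. by move=> [_ _ fE] mA ->; rewrite fE// mul1e. Qed.

(** Left multiplication moves [u] to [axis1] and right multiplication moves [t]; both preserve
    volume and norm. *)
Lemma vol4_rotation_cap_axis1 t u c : dot3 t t = 1 -> dot3 u u = 1 ->
  vol4 (rotation_cap t u c) = vol4 (rotation_cap axis1 axis1 c).
Proof.
move=> tt uu; transitivity (vol4 (rotation_cap t axis1 c)).
  have [->//|/eqP ue] := eqVneq u axis1.
  have [h1 [h2 [h3 hu]]] := half_turn_exists uu ue.
  have [h _ hn] := hu.
  apply: (scales_measure1 (vol4_mul_pure_quat h hn)).
    exact: measurable_rotation_cap.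
  apply/seteqP; split => q;
    by rewrite /rotation_cap/= normsq_mul_pure_quat// (rotdot_mul_pure_quat _ _ hu).
have [->//|/eqP te] := eqVneq t axis1.
have [h1 [h2 [h3 ht]]] := half_turn_exists tt te.
have [h _ hn] := ht.
apply: (scales_measure1 (vol4_mul_quat_pure h hn)).
  exact: measurable_rotation_cap.
apply/seteqP; split => q;
  by rewrite /rotation_cap/= normsq_mul_quat_pure// (rotdot_mul_quat_pure _ _ ht).
Qed.

(** * Areas of disks and volumes of caps of rotations *)

Definition planesq (x : plane) : R := x.1 ^+ 2 + x.2 ^+ 2.

(** The parameter is the squared radius, so that the area is linear in it. *)
Definition disk (s : R) : set plane := [set x | planesq x <= s].

Lemma measurable_planesq : measurable_fun setT (planesq : plane -> M).
Proof.
by apply: measurable_funD; apply: measurable_funX.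
Qed.

Lemma measurable_disk s : measurable (disk s).
Proof. by apply: measurable_le_set => //; exact: measurable_planesq. Qed.

Lemma planesq_ge0 x : 0 <= planesq x.
Proof. by rewrite addr_ge0// sqr_ge0. Qed.

Lemma planesq_eq0 x : (planesq x == 0) = (x == (0, 0)).
Proof. by case: x => a b; rewrite paddr_eq0 ?sqr_ge0// !sqrf_eq0. Qed.

Lemma area_disk_lty s : (area (disk s) < +oo)%E.
Proof.
pose I : set M := `[- (`|s| + 1), `|s| + 1]%classic.
apply: (@le_lt_trans _ _ (area (I `*` I))).
  apply: le_measure; rewrite ?inE; first exact: measurable_disk.
    by apply: measurableX; exact: measurable_itv.
  move=> [x y]; rewrite /disk /planesq /= => xy.
  have s1 : `|s| <= (`|s| + 1) ^+ 2 by have := normr_ge0 s; nra.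
  have H z : z ^+ 2 <= s -> z \in `[- (`|s| + 1), `|s| + 1].
    move=> zs; rewrite in_itv /= -ler_norml -(@ler_pXn2r _ 2) ?nnegrE ?addr_ge0//.
    by rewrite real_normK ?num_real// (le_trans zs)// (le_trans (ler_norm s)).
  by split; apply: H; apply: le_trans xy; rewrite ?lerDl ?lerDr ?sqr_ge0.
rewrite /area product_measure1E; [|exact: measurable_itv..].
rewrite /I /= lebesgue_measure_itv/=; case: ifP => _; last by rewrite mule0 ltry.
by rewrite -EFinD -EFinM ltry.
Qed.

Lemma area_unit_disk_gt0 : (0 < area (disk 1))%E.
Proof.
pose I : set M := `[0, 2^-1]%classic.
apply: (@lt_le_trans _ _ (area (I `*` I))); last first.
  apply: le_measure; rewrite ?inE; last 1 first.
  - move=> [x y] [] /=; rewrite /I /= !in_itv/= => /andP[x0 x1] /andP[y0 y1].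
    rewrite /disk /planesq /=; nra.
  - by apply: measurableX; exact: measurable_itv.
  - exact: measurable_disk.
rewrite /area product_measure1E; [|exact: measurable_itv..].
by rewrite /I /= lebesgue_measure_itv/= lte_fin invr_gt0 ltr0n -EFinD -EFinM
  lte_fin subr0 mulr_gt0// invr_gt0.
Qed.

Lemma area_disk s : 0 <= s -> area (disk s) = (s%:E * area (disk 1))%E.
Proof.
rewrite le_eqVlt => /predU1P[<-|s0].
  rewrite mul0e (_ : disk 0 = [set 0] `*` [set 0]); last first.
    apply/seteqP; split => [x|[x y] [/= -> ->]].
      rewrite /disk /= => x0; have : planesq x == 0 by rewrite eq_le x0 planesq_ge0.
      by rewrite planesq_eq0 => /eqP ->.
    by rewrite /disk /planesq/= expr0n addr0.
  by rewrite /area product_measure1E// [X in (X * _)%E]lebesgue_measure_set1 mul0e.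
pose r := Num.sqrt s^-1.
have r0 : 0 < r by rewrite sqrtr_gt0 invr_gt0.
have rr : r ^+ 2 = s^-1 by rewrite sqr_sqrtr// invr_ge0 ltW.
have [_ _ /(_ _ (measurable_disk 1))] := area_dilation r0.
rewrite -invfM -expr2 rr invrK => <-.
congr (area _); apply/seteqP; split => x;
  by rewrite /disk /planesq /= !exprMn -mulrDr rr mulrC ler_pdivrMr// mul1r.
Qed.

(** Archimedes' theorem for quaternions, by Cavalieri: the cap has the same section areas as the
    ball contracted in one of the two planes. *)
Lemma vol4_rotation_cap t u c : dot3 t t = 1 -> dot3 u u = 1 -> -1 < c < 1 ->
  vol4 (rotation_cap t u c) = (((1 - c) / 2)%:E * vol4 ball4)%E.
Proof.
move=> tt uu /andP[c1 c2]; rewrite vol4_rotation_cap_axis1//.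
have d0 : 0 < 1 - c by rewrite subr_gt0.
(* The cap with its two planes exchanged: its sections over the first plane are then annuli, whose
   areas are differences of disk areas. *)
pose F : set quat := [set q | planesq q.1 + planesq q.2 <= 1 /\
  c * (planesq q.1 + planesq q.2) < planesq q.2 - planesq q.1].
pose r := Num.sqrt (2 / (1 - c)).
have r0 : 0 < r by rewrite sqrtr_gt0 divr_gt0.
have rr : r ^+ 2 = 2 / (1 - c) by rewrite sqr_sqrtr// ltW// divr_gt0.
pose G : set quat := (fun q => ((r * q.1.1, r * q.1.2), q.2)) @^-1` ball4.
have FE : F = (fun q => (q.2, q.1)) @^-1` rotation_cap axis1 axis1 c.
  apply/seteqP; split => -[[a1 a2] [b1 b2]];
    rewrite /F /rotation_cap /rotdot /normsq /planesq /= !mxE /=;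
    rewrite !(mulr0, mul0r, mulr1, mul1r, addr0, addrA);
    by move=> [H1 H2]; split; lra.
have swap := scales_measure_swap area.
have mF : measurable F.
  rewrite FE -[X in measurable X]setTI; have [_ + _] := swap; apply => //.
  exact: measurable_rotation_cap.
transitivity (vol4 F).
  rewrite FE; apply/esym/(scales_measure1 swap) => //.
  exact: measurable_rotation_cap.
have id1 : scales_measure area 1 id.
  by split=> // A mA; rewrite mul1e.
have rG := scales_measure_prod (area_dilation r0) id1.
have GE : (vol4 G = ((1 - c) / 2)%:E * vol4 ball4)%E.
  have [_ _ /(_ _ measurable_ball4) ->] := rG.
  by rewrite mulr1 -invfM -expr2 rr invf_div.
have mG : measurable G.
  rewrite -[X in measurable X]setTI; have [_ + _] := rG; apply => //.
  exact: measurable_ball4.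
rewrite -GE /vol4 /product_measure1; apply: eq_integral => a _ /=.
have pa0 := planesq_ge0 a.
have -> : xsection G a = disk (1 - 2 / (1 - c) * planesq a).
  apply/seteqP; split => b;
    by rewrite /xsection /= inE /G /ball4 /disk /normsq /planesq /=
      !exprMn -mulrDr rr lerBrDl.
have -> : xsection F a =
    disk (1 - planesq a) `\` disk ((1 + c) / (1 - c) * planesq a).
  apply/seteqP; split => b; rewrite /xsection /= inE /F /disk /=.
    move=> [H1 H2]; split; first by lra.
    apply/negP; rewrite -ltNge mulrAC ltr_pdivrMr//; nra.
  move=> [H1 /negP]; rewrite -ltNge mulrAC ltr_pdivrMr// => H2.
  by split; nra.
have rho : (1 + c) / (1 - c) = 2 / (1 - c) - 1 by field; rewrite gt_eqF.
have rho0 : 0 <= (1 + c) / (1 - c) * planesq a.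
  by rewrite mulr_ge0// divr_ge0 ?ltW//; lra.
(* In the negative case both sections are empty. *)
have [neg|pos] := ltP (1 - 2 / (1 - c) * planesq a) 0.
  rewrite [X in area X](_ : _ = set0); last first.
    by apply/seteqP; split => b // -[]; rewrite /disk/= rho; move=> H1 /negP; rewrite -ltNge; lra.
  rewrite [X in _ = area X](_ : _ = set0)//.
  by apply/seteqP; split => b //; rewrite /disk/=; have := planesq_ge0 b; lra.
have axis1 : 0 <= 1 - planesq a by move: rho0; rewrite rho mulrBl mul1r; lra.
have annulus : (area (disk (1 - planesq a) `\` disk ((1 + c) / (1 - c) * planesq a)) =
    area (disk (1 - planesq a)) - area (disk ((1 + c) / (1 - c) * planesq a)))%E.
  rewrite measureD; [|exact: measurable_disk..|exact: area_disk_lty].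
  rewrite setIidr// => b; rewrite /disk /= => /le_trans; apply.
  by rewrite rho mulrBl mul1r; lra.
apply: etrans annulus _.
apply: etrans (esym (area_disk pos)).
rewrite (area_disk axis1) (area_disk rho0).
have fin : area (disk 1) \is a fin_num.
  by rewrite ge0_fin_numE//; exact: area_disk_lty.
rewrite -(fineK fin) -!EFinM -EFinD; congr (_%:E).
by rewrite rho; ring.
Qed.

Lemma vol4_ball4_lty : (vol4 ball4 < +oo)%E.
Proof.
apply: (@le_lt_trans _ _ (vol4 (disk 1 `*` disk 1))).
  apply: le_measure; rewrite ?inE.
  - exact: measurable_ball4.
  - by apply: measurableX; exact: measurable_disk.
  move=> [a b]; rewrite /ball4 /normsq /disk /=.
  rewrite -/(planesq a) -/(planesq b).
  by have := planesq_ge0 a; have := planesq_ge0 b; split=> /=; lra.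
rewrite /vol4 product_measure1E; [|exact: measurable_disk..].
by rewrite lte_mul_pinfty ?area_disk_lty// ge0_fin_numE ?area_disk_lty.
Qed.

Lemma vol4_ball4_gt0 : (0 < vol4 ball4)%E.
Proof.
apply: (@lt_le_trans _ _ (vol4 (disk 2^-1 `*` disk 2^-1))); last first.
  apply: le_measure; rewrite ?inE.
  - by apply: measurableX; exact: measurable_disk.
  - exact: measurable_ball4.
  move=> [a b]; rewrite /ball4 /normsq /disk /= => -[/= H1 H2].
  rewrite -/(planesq a) -/(planesq b); lra.
rewrite /vol4 product_measure1E; [|exact: measurable_disk..].
have d0 : (0 < area (disk 2^-1))%E.
  by rewrite area_disk ?invr_ge0// mule_gt0 ?area_unit_disk_gt0// lte_fin invr_gt0.
exact: mule_gt0.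
Qed.

(** The zero quaternion defines no rotation and is discarded as a null set. *)
Lemma vol4_punctured_ball4 : vol4 (ball4 `\` [set ((0, 0), (0, 0))]) = vol4 ball4.
Proof.
have m0 : measurable [set ((0, 0), (0, 0)) : quat].
  rewrite (_ : [set _] = disk 0 `*` disk 0).
    by apply: measurableX; exact: measurable_disk.
  apply/seteqP; split => [q ->|[a b]].
    by rewrite /disk /planesq /= expr0n addr0.
  rewrite /disk /= => -[/= a0 b0].
  have /eqP -> : a == (0, 0) by rewrite -planesq_eq0 eq_le a0 planesq_ge0.
  by have /eqP -> : b == (0, 0) by rewrite -planesq_eq0 eq_le b0 planesq_ge0.
rewrite measureD ?vol4_ball4_lty//; last exact: measurable_ball4.
apply: etrans (sube0 _); congr (_ - _)%E.
apply/eqP; rewrite eq_le measure_ge0 andbT.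
apply: (@le_trans _ _ (vol4 (disk 0 `*` disk 0))).
  apply: le_measure; rewrite ?inE.
  - by apply: measurableI => //; exact: measurable_ball4.
  - by apply: measurableX; exact: measurable_disk.
  by move=> q [_ ->]; rewrite /disk /planesq /= expr0n addr0.
rewrite /vol4 product_measure1E; [|exact: measurable_disk..].
have d0 : area (disk 0) = 0%E by rewrite area_disk// mul0e.
by rewrite [X in (X * _)%E]d0 mul0e.
Qed.

(** For q uniform in the ball, event [j] has probability [(1 - c j) / 2], so the left side of the
    last hypothesis is the expectation of the weighted count. *)
Lemma exists_rotation_below_average (J : finType) (w : J -> R)
    (t u : J -> 'rV[R]_3) (c : J -> R) (w0 : R) :
  (forall j, dot3 (t j) (t j) = 1) -> (forall j, dot3 (u j) (u j) = 1) ->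
  (forall j, -1 < c j < 1) -> \sum_j w j * ((1 - c j) / 2) < w0 ->
  exists2 q, 0 < normsq q &
    \sum_j w j * (c j * normsq q < rotdot q (t j) (u j))%R%:R < w0.
Proof.
move=> tt uu cc ww.
pose D := ball4 `\` [set ((0, 0), (0, 0))].
have normsq_neq0 q : q <> ((0, 0), (0, 0)) -> 0 < normsq q.
  move=> q0; rewrite lt0r addr_ge0 ?planesq_ge0// andbT.
  apply/negP; rewrite paddr_eq0 ?planesq_ge0// !planesq_eq0.
  by case: q q0 => a b /= q0 /andP[/eqP a0 /eqP b0]; apply: q0; rewrite a0 b0.
have mD : measurable D.
  apply: measurableD; first exact: measurable_ball4.
  rewrite (_ : [set _] = normsq @^-1` [set 0]).
    by rewrite -[X in measurable X]setTI; exact: measurable_normsq.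
  apply/seteqP; split => q /=; first by move=> ->; rewrite /normsq/= expr0n !addr0.
  by move=> q0; apply: contrapT => /normsq_neq0; rewrite q0 ltxx.
have [q [q1 q0] qw] : exists2 q, D q &
    \sum_j w j * \1_(rotation_cap (t j) (u j) (c j)) q < w0.
  apply: (@exists_below_average _ _ _ vol4) => //.
  - by apply: le_lt_trans vol4_ball4_lty; apply: le_measure; rewrite ?inE//;
      [exact: measurable_ball4|exact: subDsetl].
  - by move=> j; exact: measurable_rotation_cap.
  have V : vol4 ball4 \is a fin_num.
    by rewrite ge0_fin_numE//; exact: vol4_ball4_lty.
  have V0 : 0 < fine (vol4 ball4).
    by rewrite fine_gt0// vol4_ball4_gt0 vol4_ball4_lty.
  have -> : (\sum_j (w j)%:E * vol4 (rotation_cap (t j) (u j) (c j) `&` D) =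
      (fine (vol4 ball4) * \sum_j w j * ((1 - c j) / 2))%:E)%E.
    rewrite mulr_sumr -sumEFin; apply: eq_bigr => j _.
    rewrite setIidl; last first.
      move=> q [q1 qc]; split => // q0; move: qc.
      by rewrite q0 /rotdot /normsq /= !(expr0n, mulr0, mul0r, addr0, subr0) ltxx.
    by rewrite vol4_rotation_cap// -(fineK V) -!EFinM; congr (_%:E); ring.
  have VD : vol4 D = (fine (vol4 ball4))%:E.
    by rewrite (fineK V); exact: vol4_punctured_ball4.
  rewrite [X in (_ < _ * X)%E]VD -EFinM lte_fin.
  by rewrite mulrC ltr_pM2r.
exists q; first exact: normsq_neq0.
apply: le_lt_trans qw; apply: ler_sum => j _; rewrite indicE.
suff -> : (q \in rotation_cap (t j) (u j) (c j)) =
    (c j * normsq q < rotdot q (t j) (u j)) by [].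
by apply/idP/idP; rewrite inE /rotation_cap /=; [case|split].
Qed.

End plane_and_quaternions.

(** * Majorants of the failure event *)

Section tetrahedron_inequalities.
Context (R : realType).

(** The two identities satisfied by the scalar products of a unit vector with the vertices of an
    inscribed regular tetrahedron: the vertices sum to 0 and form a tight frame with constant
    4/3. *)
Definition tetra_values (a : 'I_4 -> R) :=
  \sum_k a k = 0 /\ \sum_k a k ^+ 2 = 4 / 3.

Lemma big_ord4 (V : nmodType) (F : 'I_4 -> V) :
  \sum_k F k = F (inord 0) + F (inord 1) + F (inord 2) + F (inord 3).
Proof.
rewrite !big_ord_recl big_ord0 addr0 !addrA.
by congr (F _ + F _ + F _ + F _); apply/val_inj; rewrite /= inordK.
Qed.

Lemma forall_ord4 (P : 'I_4 -> Prop) :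
  (forall k, P k) <-> [/\ P (inord 0), P (inord 1), P (inord 2) & P (inord 3)].
Proof.
split=> [|[P0 P1 P2 P3] k]; first by split.
rewrite -(inord_val k).
by case: k => -[|[|[|[|]]]].
Qed.

(** Two values add up to at most 2 / sqrt 3, so they cannot both exceed 1 / sqrt 3 = 0.5773..., for
    which 578/1000 is a rational upper bound. *)
Lemma two_large_tetra_values (x y z w th : R) : x + y + z + w = 0 ->
  x ^+ 2 + y ^+ 2 + z ^+ 2 + w ^+ 2 = 4 / 3 -> 578 / 1000 <= th ->
  th < x -> th < y -> False.
Proof.
move=> s0 s2 th0 tx ty.
have wE : w = - (x + y + z) by lra.
have : (x + y) ^+ 2 <= 4 / 3.
  have -> : (x + y) ^+ 2 = 4 / 3 - ((x - y) ^+ 2 + (z - w) ^+ 2) / 2.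
    by rewrite -s2 wE; field.
  have := sqr_ge0 (x - y); have := sqr_ge0 (z - w); lra.
nra.
Qed.

Lemma at_most_one_large_tetra_value (a : 'I_4 -> R) th : tetra_values a ->
  578 / 1000 <= th -> \sum_k (th < a k)%R%:R <= 1 :> R.
Proof.
rewrite /tetra_values !big_ord4.
move: (a (inord 0)) (a (inord 1)) (a (inord 2)) (a (inord 3)) => x y z w [s0 s2] th0.
have H := two_large_tetra_values.
case: (ltP th x) => [tx|_]; case: (ltP th y) => [ty|_];
  case: (ltP th z) => [tz|_]; case: (ltP th w) => [tw|_] /=;
  rewrite ?addr0 ?add0r ?lexx ?ler01//; exfalso.
all: first
  [ exact: (H x y z w th) | apply: (H x z y w th) => //; lra
  | apply: (H x w y z th) => //; lra | apply: (H y z x w th) => //; lra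
  | apply: (H y w x z th) => //; lra | apply: (H z w x y th) => //; lra ].
Qed.

Lemma tetra_value_le1 (x y z w : R) : x + y + z + w = 0 ->
  x ^+ 2 + y ^+ 2 + z ^+ 2 + w ^+ 2 = 4 / 3 -> -1 <= w.
Proof.
move=> s0 s2; have wE : w = - (x + y + z) by lra.
have : w ^+ 2 <= 1.
  have -> : w ^+ 2 = 1 - ((x - y) ^+ 2 + (y - z) ^+ 2 + (x - z) ^+ 2) / 4.
    have W : w ^+ 2 = (x + y + z) ^+ 2 by rewrite wE; ring.
    by rewrite !expr2 in W s2 *; lra.
  have := sqr_ge0 (x - y); have := sqr_ge0 (y - z); have := sqr_ge0 (x - z); lra.
nra.
Qed.

(** The quadratic (1/3 - t)(t + 1) sums to 0 over the four values. If all values were below 1/3,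
    every term would be nonnegative, hence 0, and all values would be -1, against their sum. *)
Lemma some_tetra_value_ge (a : 'I_4 -> R) s : tetra_values a ->
  (forall k, a k <= s) -> 1 / 3 <= s.
Proof.
rewrite /tetra_values forall_ord4 !big_ord4.
move: (a (inord 0)) (a (inord 1)) (a (inord 2)) (a (inord 3)) => x y z w [s0 s2].
move=> [xs ys zs ws]; rewrite leNgt; apply/negP => s3.
have w1 : -1 <= w by exact: (tetra_value_le1 s0).
have x1 : -1 <= x by apply: (@tetra_value_le1 y z w); lra.
have y1 : -1 <= y by apply: (@tetra_value_le1 x z w); lra.
have z1 : -1 <= z by apply: (@tetra_value_le1 x y w); lra.
have P (t : R) : -1 <= t -> t <= s -> 0 <= (1 / 3 - t) * (t + 1).
  by move=> t1 ts; apply: mulr_ge0; lra.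
have := P _ x1 xs; have := P _ y1 ys; have := P _ z1 zs; have := P _ w1 ws.
have E (t : R) : (1 / 3 - t) * (t + 1) = 1 / 3 - 2 / 3 * t - t ^+ 2 by field.
rewrite !E => pw pz py px.
have Q (t : R) : -1 <= t -> t <= s -> (1 / 3 - t) * (t + 1) <= 0 -> t = -1.
  by move=> t1 ts ht; apply/eqP; rewrite eq_le t1 andbT; nra.
have xE : x = -1 by apply: Q => //; rewrite E; lra.
have yE : y = -1 by apply: Q => //; rewrite E; lra.
have zE : z = -1 by apply: Q => //; rewrite E; lra.
have wE : w = -1 by apply: Q => //; rewrite E; lra.
lra.
Qed.

(** With r = 0.45, the second elementary symmetric function of r - x, r - y, r - z is nonnegative.
    It equals w^2 + 2 r w + 3 r^2 - 2/3, whose roots are about 0.06 and -0.9615. *)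
Lemma very_negative_tetra_value (x y z w s : R) : x + y + z + w = 0 ->
  x ^+ 2 + y ^+ 2 + z ^+ 2 + w ^+ 2 = 4 / 3 -> s <= 45 / 100 ->
  x <= s -> y <= s -> z <= s -> w <= 0 -> w <= - (96 / 100).
Proof.
move=> s0 s2 ss xs ys zs w0; rewrite leNgt; apply/negP => w1.
pose r : R := 45 / 100.
have : 0 <= (r - x) * (r - y) + (r - y) * (r - z) + (r - x) * (r - z).
  by rewrite !addr_ge0// mulr_ge0// /r; lra.
have -> : (r - x) * (r - y) + (r - y) * (r - z) + (r - x) * (r - z) =
   3 * r ^+ 2 - 2 * r * (x + y + z)
   + ((x + y + z) ^+ 2 - (x ^+ 2 + y ^+ 2 + z ^+ 2)) / 2 by field.
have -> : x + y + z = - w by lra.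
have -> : x ^+ 2 + y ^+ 2 + z ^+ 2 = 4 / 3 - w ^+ 2 by lra.
rewrite /r; nra.
Qed.

(** As the sum is 0, some value is nonpositive, and the previous bound applies to it. The sum counts
    the values at most -0.96. *)
Lemma some_very_negative_tetra_value (a : 'I_4 -> R) s : tetra_values a ->
  s <= 45 / 100 -> (forall k, a k <= s) ->
  1 <= \sum_k (1 - (- (96 / 100) < a k)%R%:R) :> R.
Proof.
rewrite /tetra_values forall_ord4 !big_ord4.
move: (a (inord 0)) (a (inord 1)) (a (inord 2)) (a (inord 3)) => x y z w [s0 s2].
move=> ss [xs ys zs ws].
have H : [\/ x <= - (96 / 100), y <= - (96 / 100), z <= - (96 / 100)
   | w <= - (96 / 100)].
  have [w0|w0] := leP w 0.
    by constructor 4; apply: (@very_negative_tetra_value x y z w s) => //; lra.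
  have [x0|x0] := leP x 0.
    by constructor 1; apply: (@very_negative_tetra_value y z w x s) => //; lra.
  have [y0|y0] := leP y 0.
    by constructor 2; apply: (@very_negative_tetra_value x z w y s) => //; lra.
  by constructor 3; apply: (@very_negative_tetra_value x y w z s) => //; lra.
have P (t : R) : 0 <= 1 - (- (96 / 100) < t)%R%:R :> R.
  by case: (_ < _); rewrite /= ?subr0 ?subrr.
have Q (t : R) : t <= - (96 / 100) -> 1 - (- (96 / 100) < t)%R%:R = 1 :> R.
  by rewrite leNgt => /negbTE ->; rewrite subr0.
have := P x; have := P y; have := P z; have := P w.
by case: H => /Q ->; lra.
Qed.

(* [a] collects the scalar products of a unit vector with the vertices of a
   random tetrahedron, each uniform in [-1, 1]; hence [be + 2 * om * (1 - th)]
   is the mean of the majorant, to be compared with three times the area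
   fraction [(1 - c) / 2] of the cap. *)
Lemma fail_majorant (s c : R) : 0 <= s -> 0 < c -> c < 1 -> s ^+ 2 + c ^+ 2 = 1 ->
  exists be om th : R,
    [/\ -1 < th < 1, be + 2 * om * (1 - th) <= 3 / 2 * (1 - c),
        s <> 4 / 5 -> be + 2 * om * (1 - th) < 3 / 2 * (1 - c)
      & forall a, tetra_values a ->
          (`[< forall k, a k <= s >])%:R <= be + om * \sum_k (th < a k)%R%:R].
Proof.
move=> s0 c0 c1 sc.
have s1 : s < 1 by nra.
have [sbig|ssmall] := leP (45 / 100) s.
  have c894 : c <= 894 / 1000 by nra.
  (* Wide caps: the majorant is 1 minus the number of values above [th], which is at most 1 by the
     choice of [th]. *)
  pose th := Num.max s (578 / 1000).
  have ths : s <= th by rewrite le_max lexx.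
  have th1 : 578 / 1000 <= th by rewrite le_max lexx orbT.
  have maj a : tetra_values a ->
      (`[< forall k, a k <= s >])%:R <= 1 - 1 * \sum_k (th < a k)%R%:R :> R.
    move=> ta; have le1 := at_most_one_large_tetra_value ta th1.
    case: asboolP => [as_|_] /=; last by lra.
    by rewrite big1 ?mulr0 ?subr0// => k _; rewrite ltNge (le_trans (as_ k) ths).
  exists 1, (-1), th; split.
  - by rewrite /th lt_max gt_max s1 /=; apply/andP; split; [apply/orP; left|]; lra.
  - rewrite /th; case: (leP s (578 / 1000)) => H; first by lra.
    (* For [th = s] the claim is 2 s + (3/2) c <= 5/2, by Cauchy-Schwarz, with equality only at
       (4/5, 3/5). *)
    have := sqr_ge0 (s - 4 / 5); have := sqr_ge0 (c - 3 / 5).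
    rewrite !expr2 in sc *; lra.
  - rewrite /th; case: (leP s (578 / 1000)) => H s45; first by lra.
    have : 0 < (s - 4 / 5) ^+ 2.
      by rewrite lt0r sqr_ge0 andbT sqrf_eq0 subr_eq0; apply/eqP.
    have := sqr_ge0 (c - 3 / 5).
    rewrite !expr2 in sc *; lra.
  - by move=> a ta; rewrite mulN1r; have := maj a ta; rewrite mul1r.
have [s3|s3] := ltP s (1 / 3).
  (* Narrow caps are never missed, so the majorant is 0. *)
  exists 0, 0, 0; split; rewrite ?oppr_lt0 ?ltr01//; [by lra|by move=> _; lra|].
  move=> a ta; case: asboolP => [as_|_] /=; last by rewrite mul0r addr0.
  by have := some_tetra_value_ge ta as_; lra.
have c945 : c <= 945 / 1000 by nra.
(* Medium caps: the majorant counts the values at most -0.96 and has mean 0.08, while the allowance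
   is at least (3/2)(1 - 0.945) = 0.0825. *)
exists 4, (-1), (- (96 / 100)); split.
- by apply/andP; split; lra.
- by lra.
- by move=> _; lra.
- move=> a ta.
  have E : \sum_k (1 - (- (96 / 100) < a k)%R%:R) =
      4 + -1 * \sum_k (- (96 / 100) < a k)%R%:R :> R.
    by rewrite sumrB mulN1r sumr_const card_ord.
  rewrite -E; case: asboolP => [as_|_] /=.
    exact: (some_very_negative_tetra_value ta (ltW ssmall) as_).
  by apply: sumr_ge0 => k _; case: (_ < _); rewrite /= ?subr0 ?subrr.
Qed.

End tetrahedron_inequalities.

(** * A good rotated tetrahedron *)

Section few_unilluminated_vertices.
Context (R : realType).
Local Notation quat := ((measurableTypeR R * measurableTypeR R) *
  (measurableTypeR R * measurableTypeR R))%type.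

Definition row3 (x y z : R) : 'rV[R]_3 :=
  \row_j (if j == 0 then x else if j == 1 then y else z).

Lemma row3_0 x y z : row3 x y z 0 0 = x. Proof. by rewrite mxE. Qed.
Lemma row3_1 x y z : row3 x y z 0 1 = y. Proof. by rewrite mxE. Qed.
Lemma row3_2 x y z : row3 x y z 0 2 = z. Proof. by rewrite mxE. Qed.
Definition row3E := (row3_0, row3_1, row3_2).

(** Alternate vertices of the cube inscribed in the unit sphere. *)
Definition tetra (k : 'I_4) : 'rV[R]_3 :=
  let sg (b : bool) := if b then (Num.sqrt 3)^-1 else - (Num.sqrt 3)^-1 : R in
  row3 (sg ((k == 0 :> nat) || (k == 1 :> nat)))
       (sg ((k == 0 :> nat) || (k == 2 :> nat)))
       (sg ((k == 0 :> nat) || (k == 3 :> nat))).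

Lemma sqrt3V2 : (Num.sqrt 3)^-1 ^+ 2 = 1 / 3 :> R.
Proof. by rewrite exprVn sqr_sqrtr ?ler0n// div1r. Qed.

Lemma dot3_tetra k : dot3 (tetra k) (tetra k) = 1.
Proof.
rewrite /dot3 /tetra !row3E -!expr2.
have E (b : bool) : (if b then (Num.sqrt 3)^-1 else - (Num.sqrt 3)^-1) ^+ 2 = 1 / 3 :> R.
  by case: b; rewrite ?sqrrN sqrt3V2.
by rewrite !E; field.
Qed.

Lemma rotdot_row3 (q : quat) x y z u : rotdot q (row3 x y z) u =
  x * rotdot q (row3 1 0 0) u + y * rotdot q (row3 0 1 0) u
  + z * rotdot q (row3 0 0 1) u.
Proof. by rewrite /rotdot !row3E; ring. Qed.

Lemma rotdot_parseval (q : quat) u : rotdot q (row3 1 0 0) u ^+ 2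
  + rotdot q (row3 0 1 0) u ^+ 2 + rotdot q (row3 0 0 1) u ^+ 2 =
  normsq q ^+ 2 * dot3 u u.
Proof. by rewrite /rotdot /normsq /dot3 !row3E; ring. Qed.

Lemma rotation_tetra_values (q : quat) u : 0 < normsq q -> dot3 u u = 1 ->
  tetra_values (fun k => rotdot q (tetra k) u / normsq q).
Proof.
move=> N0 uu; have := rotdot_parseval q u; rewrite uu mulr1.
rewrite /tetra_values !big_ord4 /tetra !inordK//=.
rewrite !(rotdot_row3 q (Num.sqrt 3)^-1) !(rotdot_row3 q (- (Num.sqrt 3)^-1)).
set s := (Num.sqrt 3)^-1.
set x := rotdot _ _ _; set y := rotdot _ _ _; set z := rotdot _ _ _ => P.
have Nn0 : normsq q != 0 by rewrite gt_eqF.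
split; first by field.
have -> : 4 / 3 = 4 * s ^+ 2 * (x ^+ 2 + y ^+ 2 + z ^+ 2) / normsq q ^+ 2.
  by rewrite P sqrt3V2; field.
by field.
Qed.

(** For m >= 5 the expansion of the squared norm of the sum of the [u i] would be negative. The
    bound -7/25 is cos (2 phi) for cos phi = 3/5. *)
Lemma few_wide_caps (m : nat) (u : 'I_m -> 'rV[R]_3) :
  (forall i, dot3 (u i) (u i) = 1) ->
  (forall i j, i != j -> dot3 (u i) (u j) <= - (7 / 25)) -> (m <= 4)%N.
Proof.
move=> uu ud; rewrite leqNgt; apply/negP => m5.
have H i : \sum_j dot3 (u i) (u j) <= 1 - 7 / 25 * (m%:R - 1).
  rewrite (bigD1 i)//= uu lerD2l.
  apply: (@le_trans _ _ (\sum_(j < m | j != i) - (7 / 25))).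
    by apply: ler_sum => j ji; apply: ud; rewrite eq_sym.
  have mE : m.-1%:R = m%:R - 1 :> R by rewrite -subn1 natrB// (leq_trans _ m5).
  by rewrite sumr_const cardC1 card_ord -[_ *+ m.-1]mulr_natr mE mulNr.
have : 0 <= \sum_i \sum_j dot3 (u i) (u j).
  have -> : \sum_i \sum_j dot3 (u i) (u j) = (\sum_i u i 0 0) ^+ 2
      + (\sum_i u i 0 1) ^+ 2 + (\sum_i u i 0 2) ^+ 2.
    rewrite !expr2 !big_distrlr /= -!big_split /=.
    by apply: eq_bigr => i _; rewrite -!big_split.
  by rewrite !addr_ge0 ?sqr_ge0.
apply/negP; rewrite -ltNge.
apply: (@le_lt_trans _ _ (\sum_(i < m) (1 - 7 / 25 * (m%:R - 1)))).
  by apply: ler_sum.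
have m5R : 5 <= m%:R :> R by rewrite ler_nat.
rewrite sumr_const card_ord -[_ *+ m]mulr_natr; nra.
Qed.

(** The averaged quantity is the majorant of the number of misses minus [tau] times the number of
    pairs (cap, tetrahedron vertex in it). By packing there are at most 4 such pairs, so a value
    below [3 - 4 * tau] leaves fewer than 3 misses. *)
Lemma few_unilluminated_of_means (m : nat) (u : 'I_m -> 'rV[R]_3)
    (s c be om th : 'I_m -> R) (tau : R) :
  (forall i, dot3 (u i) (u i) = 1) -> (forall i, 0 < c i < 1) ->
  (forall i, -1 < th i < 1) ->
  (forall i a, tetra_values a ->
     (`[< forall k, a k <= s i >])%:R <= be i + om i * \sum_k (th i < a k)%R%:R) ->
  (forall (q : quat) k, 0 < normsq q ->
     \sum_i (c i * normsq q < rotdot q (tetra k) (u i))%R%:R <= 1 :> R) ->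
  0 <= tau ->
  \sum_i (be i + 2 * om i * (1 - th i)) - 2 * tau * \sum_i (1 - c i) < 3 - 4 * tau ->
  exists2 q : quat, 0 < normsq q &
    (#|[pred i | `[< (forall k, rotdot q (tetra k) (u i) <= s i * normsq q)%R >]]| <= 2)%N.
Proof.
move=> uu c01 th1 maj packing tau0 mean.
pose J := ('I_m * 'I_4 * bool)%type.
(* The Boolean tells the majorant events from the packing events. *)
pose w (j : J) := if j.2 then om j.1.1 else - tau.
pose cc (j : J) := if j.2 then th j.1.1 else c j.1.1.
have sumJ (F : J -> R) : \sum_j F j =
    \sum_i \sum_k (F (i, k, true) + F (i, k, false)).
  transitivity (\sum_(p : 'I_m * 'I_4) \sum_(b : bool) F (p, b)).
    by rewrite pair_big; apply: eq_bigr => -[].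
  by rewrite [RHS]pair_big; apply: eq_bigr => -[i k] _; rewrite big_bool.
have [||||q N0] := @exists_rotation_below_average R J w
    (fun j => tetra j.1.2) (fun j => u j.1.1) cc (3 - 4 * tau - \sum_i be i).
- by move=> j; exact: dot3_tetra.
- by move=> j; exact: uu.
- move=> [[i k] []]; rewrite /cc/=; first exact: th1.
  by have /andP[] := c01 i; lra.
- rewrite ltrBrDr; apply: le_lt_trans mean; rewrite sumJ /w /cc /=.
  under eq_bigr do rewrite sumr_const card_ord.
  rewrite mulr_sumr -big_split -sumrB /=; apply: ler_sum => i _.
  rewrite -[_ *+ 4]mulr_natr; lra.
rewrite sumJ /w /cc /= ltrBrDr => qw; exists q => //.
rewrite -ltnS -(ltr_nat R) -sum1_card natr_sum.
have fail : \sum_(i in [pred i | `[< (forall k, rotdot q (tetra k) (u i) <= s i * normsq q)%R >]]) 1%:R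
    <= \sum_i (be i + om i * \sum_k (th i * normsq q < rotdot q (tetra k) (u i))%R%:R).
  rewrite big_mkcond /=; apply: ler_sum => i _.
  have := maj i _ (rotation_tetra_values N0 (uu i)).
  rewrite (eq_bigr (fun k => (th i * normsq q < rotdot q (tetra k) (u i))%R%:R)); last first.
    by move=> k _; rewrite ltr_pdivlMr.
  apply: le_trans; rewrite unfold_in /=.
  case: asboolP => [H|_]; last by rewrite ler0n.
  by rewrite asboolT// => k; rewrite ler_pdivrMr.
apply: le_lt_trans fail _.
have pack : \sum_i \sum_k (c i * normsq q < rotdot q (tetra k) (u i))%R%:R <= 4 :> R.
  rewrite exchange_big /=; apply: (@le_trans _ _ (\sum_(k < 4) 1)).
    by apply: ler_sum => k _; exact: packing.
  by rewrite sumr_const card_ord.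
have {}pack := ler_wpM2l tau0 pack.
move: qw; under eq_bigr do rewrite big_split -!mulr_sumr /=.
rewrite !big_split /= -mulr_sumr mulNr; lra.
Qed.

(** * Rotations of R^3 and disjoint caps *)

Definition rotvec (q : quat) (t : 'rV[R]_3) : 'rV[R]_3 :=
  row3 (rotdot q t (row3 1 0 0)) (rotdot q t (row3 0 1 0)) (rotdot q t (row3 0 0 1)).

Definition rotation (q : quat) (t : 'rV[R]_3) : 'rV[R]_3 :=
  (normsq q)^-1 *: rotvec q t.

Lemma dot3C (x y : 'rV[R]_3) : dot3 x y = dot3 y x.
Proof. by rewrite /dot3; ring. Qed.

Lemma dot3Dl (x y z : 'rV[R]_3) : dot3 (x + y) z = dot3 x z + dot3 y z.
Proof. by rewrite /dot3 !mxE; ring. Qed.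

Lemma dot3Zl a (x z : 'rV[R]_3) : dot3 (a *: x) z = a * dot3 x z.
Proof. by rewrite /dot3 !mxE; ring. Qed.

Lemma dot3Dr (x y z : 'rV[R]_3) : dot3 z (x + y) = dot3 z x + dot3 z y.
Proof. by rewrite /dot3 !mxE; ring. Qed.

Lemma dot3Zr a (x z : 'rV[R]_3) : dot3 z (a *: x) = a * dot3 z x.
Proof. by rewrite /dot3 !mxE; ring. Qed.

Lemma dot3_ge0 (x : 'rV[R]_3) : 0 <= dot3 x x.
Proof. by rewrite /dot3 -!expr2 !addr_ge0 ?sqr_ge0. Qed.

Lemma dot3_rotation (q : quat) t y :
  dot3 (rotation q t) y = rotdot q t y / normsq q.
Proof.
by rewrite /rotation dot3Zl mulrC /rotvec /dot3 !row3E /rotdot !row3E; congr (_ / _); ring.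
Qed.

Lemma rotation_isometry (q : quat) s t : 0 < normsq q ->
  dot3 (rotation q s) (rotation q t) = dot3 s t.
Proof.
move=> N0; rewrite /rotation dot3Zl dot3Zr.
have -> : dot3 (rotvec q s) (rotvec q t) = normsq q * normsq q * dot3 s t.
  by rewrite /rotvec /dot3 !row3E /rotdot /normsq !row3E; ring.
by field; rewrite gt_eqF.
Qed.

Lemma few_unilluminated_vertices (m : nat) (u : 'I_m -> 'rV[R]_3)
    (s c : 'I_m -> R) :
  (forall i, dot3 (u i) (u i) = 1) -> (forall i, 0 <= s i) ->
  (forall i, 0 < c i < 1) -> (forall i, s i ^+ 2 + c i ^+ 2 = 1) ->
  (forall z i j, dot3 z z = 1 -> c i < dot3 z (u i) -> c j < dot3 z (u j) -> i = j) ->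
  exists2 q : quat, 0 < normsq q &
    (#|[pred i | `[< (forall k, rotdot q (tetra k) (u i) <= s i * normsq q)%R >]]| <= 2)%N.
Proof.
move=> uu s0 c01 sc disj.
have /choice[bot botP] : forall i, exists b : R * R * R,
    [/\ -1 < b.2 < 1, b.1.1 + 2 * b.1.2 * (1 - b.2) <= 3 / 2 * (1 - c i),
        s i <> 4 / 5 -> b.1.1 + 2 * b.1.2 * (1 - b.2) < 3 / 2 * (1 - c i)
      & forall a, tetra_values a ->
          (`[< forall k, a k <= s i >])%:R <= b.1.1 + b.1.2 * \sum_k (b.2 < a k)%R%:R].
  move=> i; have /andP[ci0 ci1] := c01 i.
  have [be [om [th H]]] := fail_majorant (s0 i) ci0 ci1 (sc i).
  exists (be, om, th); exact: H.
have packing (q : quat) k : 0 < normsq q ->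
    \sum_i (c i * normsq q < rotdot q (tetra k) (u i))%R%:R <= 1 :> R.
  move=> N0; have [[i ci]|none] :=
      pselect (exists i, c i * normsq q < rotdot q (tetra k) (u i)); last first.
    by rewrite big1 ?ler01// => i _; case: (boolP (_ < _)) => // ci; case: none; exists i.
  rewrite (bigD1 i)//= ci big1 ?addr0// => j ji.
  suff : ~~ (c j * normsq q < rotdot q (tetra k) (u j)) by move=> /negbTE ->.
  apply: contra ji => cj; apply/eqP/(disj (rotation q (tetra k))).
  - by rewrite rotation_isometry// dot3_tetra.
  - by rewrite dot3_rotation ltr_pdivlMr.
  - by rewrite dot3_rotation ltr_pdivlMr.
have th1 i : -1 < (bot i).2 < 1 by have [] := botP i.
have maj i a : tetra_values a -> (`[< forall k, a k <= s i >])%:R <=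
    (bot i).1.1 + (bot i).1.2 * \sum_k ((bot i).2 < a k)%R%:R.
  by have [_ _ _] := botP i; exact.
have le i : (bot i).1.1 + 2 * (bot i).1.2 * (1 - (bot i).2) <= 3 / 2 * (1 - c i).
  by have [] := botP i.
have [[i si]|wide] := pselect (exists i, s i <> 4 / 5).
  (* With [tau = 3 / 4] each cap contributes at most 0 and cap [i] strictly less, while
     [3 - 4 * tau = 0]. *)
  apply: (few_unilluminated_of_means (tau := 3 / 4) uu c01 th1 maj packing) => //.
  rewrite mulr_sumr -sumrB.
  apply: (@lt_le_trans _ _ 0); last by lra.
  rewrite (bigD1 i)//=; apply: ltr_wnDr.
    by apply: sumr_le0 => j _; have := le j; lra.
  by have [_ _ /(_ si) + _] := botP i; lra.
have s45 i : s i = 4 / 5 by apply: contrapT => si; apply: wide; exists i.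
have c35 i : c i = 3 / 5.
  have /andP[ci0 _] := c01 i.
  have := sc i; rewrite s45 !expr2 => E.
  have /eqP : (c i - 3 / 5) * (c i + 3 / 5) = 0 by lra.
  by rewrite mulf_eq0 => /orP[] /eqP; lra.
have m4 : (m <= 4)%N.
  (* If two centres were closer, the unit vector bisecting them would have scalar product
     [n / 2 > 3 / 5] with both and lie in both caps. *)
  apply: (few_wide_caps uu) => i j ij; rewrite leNgt; apply/negP => d.
  have d2 : dot3 (u i + u j) (u i + u j) = 2 + 2 * dot3 (u i) (u j).
    by rewrite dot3Dl !dot3Dr !uu (dot3C (u j)); ring.
  pose n := Num.sqrt (2 + 2 * dot3 (u i) (u j)).
  have nn : n ^+ 2 = 2 + 2 * dot3 (u i) (u j) by rewrite sqr_sqrtr//; lra.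
  have n0 : 0 < n by rewrite sqrtr_gt0; lra.
  have n65 : 6 / 5 < n by rewrite expr2 in nn; nra.
  have nn0 : n != 0 by rewrite gt_eqF.
  have dE : dot3 (u i) (u j) = n ^+ 2 / 2 - 1 by rewrite nn; field.
  have nE : n^-1 * (n ^+ 2 / 2) = n / 2 by field.
  move/eqP: ij; apply; apply: (disj (n^-1 *: (u i + u j))).
  - by rewrite dot3Zl dot3Zr d2 -nn; field.
  - by rewrite c35 dot3Zl dot3Dl uu (dot3C (u j)) dE addrC subrK nE; lra.
  - by rewrite c35 dot3Zl dot3Dl uu dE subrK nE; lra.
(* At most four caps, each contributing at most 3/5: the mean is at most 12/5. *)
apply: (few_unilluminated_of_means (tau := 0) uu c01 th1 maj packing) => //.
rewrite !mulr0 mul0r !subr0.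
apply: (@le_lt_trans _ _ (\sum_(i < m) (3 / 5))).
  by apply: ler_sum => i _; apply: le_trans (le i) _; rewrite c35; lra.
have m4R : m%:R <= 4 :> R by rewrite ler_nat.
by rewrite sumr_const card_ord -[_ *+ m]mulr_natr; lra.
Qed.

End few_unilluminated_vertices.

(** * Geometry of cap bodies *)

Section cap_body_geometry.
Context (R : realType).
Implicit Types x y z b p : 'rV[R]_3.

Lemma sum_ord3 (F : 'I_3 -> R) : \sum_i F i = F 0 + F 1 + F 2.
Proof.
rewrite !big_ord_recl big_ord0 addr0 !addrA.
by congr (F _ + F _ + F _); apply/val_inj.
Qed.

Lemma enorm_dot3 x : enorm x = Num.sqrt (dot3 x x).
Proof. by rewrite /enorm sum_ord3 /dot3 !expr2. Qed.

Lemma unit_ballE x : unit_ball x = (dot3 x x <= 1) :> Prop.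
Proof.
by rewrite /unit_ball /= enorm_dot3 -[X in _ <= X]sqrtr1 ler_sqrt.
Qed.

Lemma unit_sphereP x : unit_sphere x <-> dot3 x x = 1.
Proof.
rewrite /unit_sphere /= enorm_dot3; split=> [H|->]; last by rewrite sqrtr1.
by rewrite -(sqr_sqrtr (dot3_ge0 x)) H expr1n.
Qed.

Lemma dot3_convex x y t :
  dot3 ((1 - t) *: x + t *: y) ((1 - t) *: x + t *: y) =
  (1 - t) * dot3 x x + t * dot3 y y - t * (1 - t) * dot3 (x - y) (x - y).
Proof. by rewrite /dot3 !mxE; ring. Qed.

Lemma unit_ball_convex x y t : unit_ball x -> unit_ball y -> 0 <= t <= 1 ->
  unit_ball ((1 - t) *: x + t *: y).
Proof.
rewrite !unit_ballE dot3_convex => x1 y1 /andP[t0 t1].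
have := dot3_ge0 (x - y); set d := dot3 (x - y) _ => d0.
have : 0 <= t * (1 - t) * d by rewrite !mulr_ge0//; lra.
have : 0 <= (1 - t) * (1 - dot3 x x) by rewrite mulr_ge0//; lra.
have : 0 <= t * (1 - dot3 y y) by rewrite mulr_ge0//; lra.
lra.
Qed.

Lemma dot3_le1 x y : dot3 x x <= 1 -> dot3 y y <= 1 -> dot3 x y <= 1.
Proof.
move=> x1 y1; have := dot3_ge0 (x - y).
have -> : dot3 (x - y) (x - y) = dot3 x x + dot3 y y - 2 * dot3 x y.
  by rewrite /dot3 !mxE; ring.
lra.
Qed.

Lemma convex_setP (A : set 'rV[R]_3) : convex_set A <->
  forall x y t, A x -> A y -> 0 <= t <= 1 -> A ((1 - t) *: x + t *: y).
Proof.
split=> [cA x y t Ax Ay /andP[t0 t1]|cA x y l].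
  have := cA y x (Itv01 t0 t1); rewrite !inE => /(_ Ay Ax).
  by rewrite addrC.
rewrite !inE => Ax Ay; have l01 : 0 <= l%:num <= 1 by rewrite ge0 le1.
by have := cA y x _ Ay Ax l01; rewrite addrC.
Qed.

Lemma continuous_coord (j : 'I_3) : continuous (fun x : 'rV[R]_3 => x 0 j).
Proof. exact: coord_continuous. Qed.

Lemma continuous_dot3 : continuous (fun x : 'rV[R]_3 => dot3 x x).
Proof.
move=> x; have c j := @continuous_coord j x.
exact: (cvgD (cvgD (cvgM (c 0) (c 0)) (cvgM (c 1) (c 1))) (cvgM (c 2) (c 2))).
Qed.

Lemma closed_unit_ball : closed (@unit_ball R 3).
Proof.
rewrite (_ : @unit_ball R 3 = (fun x => dot3 x x) @^-1` [set r | r <= 1]).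
  apply: (@closed_comp _ _ _ [set r : R | r <= 1]); last exact: (@closed_le R 1).
  by move=> x _; exact: continuous_dot3.
by apply/seteqP; split => x /=; rewrite unit_ballE.
Qed.

Lemma open_open_ball : open [set x : 'rV[R]_3 | dot3 x x < 1].
Proof.
rewrite (_ : [set _ | _] = (fun x => dot3 x x) @^-1` [set r | r < 1])//.
apply: (@open_comp _ _ _ [set r : R | r < 1]); last exact: (@open_lt R 1).
by move=> x _; exact: continuous_dot3.
Qed.

Lemma compact_unit_ball : compact (@unit_ball R 3).
Proof.
apply: bounded_closed_compact; last exact: closed_unit_ball.
exists 1; split=> // M M1 x; rewrite unit_ballE => x1.
rewrite /Num.norm/= mx_normrE; apply: bigmax_le => /=; first by rewrite ltW// (lt_trans _ M1).
move=> [i j] _ /=; rewrite ord1; apply: le_trans (ltW M1).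
have H : x 0 j ^+ 2 <= dot3 x x.
  rewrite /dot3 -!expr2.
  have := sqr_ge0 (x 0 0); have := sqr_ge0 (x 0 1); have := sqr_ge0 (x 0 2).
  case: j => -[|[|[|//]]] lt.
  - by rewrite (_ : Ordinal lt = 0)//; [lra|exact/val_inj].
  - by rewrite (_ : Ordinal lt = 1)//; [lra|exact/val_inj].
  - by rewrite (_ : Ordinal lt = 2)//; [lra|exact/val_inj].
rewrite -(@ler_pXn2r _ 2)// ?nnegrE// expr1n real_normK ?num_real//.
exact: le_trans H x1.
Qed.

(* The point [mu X + nu X'] of the cone over a segment [X, X'] through the
   point [y] lies in the cone over [X, y] or in the cone over [y, X']. *)
Lemma split_at_segment_point (X X' : 'rV[R]_3) (mu nu tau : R) :
  0 <= mu -> 0 <= nu -> 0 <= tau -> nu * (1 - tau) <= mu * tau ->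
  exists ga de : R, [/\ 0 <= ga, 0 <= de, ga + de = mu + nu &
    mu *: X + nu *: X' = ga *: ((1 - tau) *: X + tau *: X') + de *: X].
Proof.
move=> mu0 nu0 tau0 le.
have [tauE|tau_neq0] := eqVneq tau 0.
  have -> : nu = 0 by rewrite tauE in le; lra.
  by exists 0, mu; split; rewrite // ?add0r ?addr0// !scale0r add0r addr0.
have taup : 0 < tau by rewrite lt0r tau_neq0.
exists (nu / tau), (mu + nu - nu / tau); split.
- by rewrite divr_ge0.
- rewrite -(pmulr_lge0 _ taup) mulrBl divfK//; lra.
- by ring.
- by apply/rowP => j; rewrite !mxE; field.
Qed.

Lemma unit_ball_comb (b b' y : 'rV[R]_3) (al al' ga : R) :
  unit_ball b -> unit_ball b' -> unit_ball y ->
  0 <= al -> 0 <= al' -> 0 <= ga ->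
  exists2 c, unit_ball c &
    al *: b + al' *: b' + ga *: y = (al + al' + ga) *: c.
Proof.
have two (b1 b2 : 'rV[R]_3) (r1 r2 : R) : unit_ball b1 -> unit_ball b2 ->
    0 <= r1 -> 0 <= r2 ->
    exists2 c, unit_ball c & r1 *: b1 + r2 *: b2 = (r1 + r2) *: c.
  move=> h1 h2 p1 p2; have [r0|r0] := eqVneq (r1 + r2) 0.
    have [-> ->] : r1 = 0 /\ r2 = 0 by split; lra.
    by exists b1 => //; rewrite addr0 !scale0r addr0.
  have rp : 0 < r1 + r2 by rewrite lt0r r0 addr_ge0.
  exists ((1 - r2 / (r1 + r2)) *: b1 + (r2 / (r1 + r2)) *: b2).
    apply: unit_ball_convex => //.
    by rewrite divr_ge0 ?addr_ge0//= ler_pdivrMr// mul1r lerDr.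
  by apply/rowP => j; rewrite !mxE; field.
move=> hb hb' hy al0 al'0 ga0.
have [c1 c1b ->] := two _ _ _ _ hb hb' al0 al'0.
by have [c2 c2b ->] := two _ _ _ _ c1b hy (addr_ge0 al0 al'0) ga0; exists c2.
Qed.

(** * The hull as a union of cones over the ball *)

Section spiky_ball.
Variables (m : nat) (x : 'I_m -> 'rV[R]_3).
Hypothesis meet : forall i j : 'I_m, (i < j)%N ->
  segment (x i) (x j) `&` @unit_ball R 3 !=set0.

(* [None] indexes the centre of the ball, as a degenerate vertex. *)
Definition spike (o : option 'I_m) : 'rV[R]_3 := if o is Some i then x i else 0.

Definition spiky_ball : set 'rV[R]_3 :=
  [set p | exists o b t, [/\ unit_ball b, 0 <= t <= 1 &
    p = (1 - t) *: b + t *: spike o]].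

Lemma unit_ball0 : unit_ball (0 : 'rV[R]_3).
Proof. by rewrite unit_ballE /dot3 !mxE !mulr0 !addr0 ler01. Qed.

Lemma closed_spiky_ball : closed spiky_ball.
Proof.
have -> : spiky_ball = \bigcup_(o in [set: option 'I_m])
   ((fun bt : 'rV[R]_3 * R => (1 - bt.2) *: bt.1 + bt.2 *: spike o)
     @` (@unit_ball R 3 `*` `[0, 1])).
  apply/seteqP; split => p.
    move=> [ o [b [t [hb ht ->]]]]; exists o => //.
    by exists (b, t); [split => //=; rewrite in_itv|].
  by move=> [ o _ [[b t] [/= hb]]]; rewrite in_itv/= => ht <-; exists o, b, t.
apply: closed_bigcup; first exact: finite_finset.
move=> o _; apply: compact_closed; first exact: norm_hausdorff.
apply: continuous_compact.
  apply: continuous_subspaceT => bt.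
  apply: cvgD.
    by apply: cvgZ; [apply: cvgB; [exact: cvg_cst|exact: cvg_snd]|exact: cvg_fst].
  by apply: cvgZ; [exact: cvg_snd|exact: cvg_cst].
by apply: compact_setX; [exact: compact_unit_ball|exact: segment_compact].
Qed.

Lemma spike_segment o o' : o != o' -> exists2 t, 0 <= t <= 1 &
  unit_ball ((1 - t) *: spike o + t *: spike o').
Proof.
have seg (i j : 'I_m) : (i < j)%N -> exists2 t, 0 <= t <= 1 &
    unit_ball ((1 - t) *: x i + t *: x j).
  by move=> /meet[z [[t /=]]]; rewrite in_itv/= => t01 <- ?; exists t.
case: o o' => [i|] [j|] //= ij.
- case: (ltngtP i j) => [/seg//|/seg[t t01 ht]|/val_inj ijE]; last first.
    by rewrite ijE eqxx in ij.
  by exists (1 - t); [lra|rewrite subKr addrC].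
- by exists 1; [lra|rewrite scaler0 addr0 subrr scale0r; exact: unit_ball0].
- by exists 0; [lra|rewrite scaler0 add0r scale0r; exact: unit_ball0].
Qed.

(** The segment between two vertices meets the ball at some [y]; a point of it lies on one side of
    [y], so the vertex on the other side can be traded for [y]. *)
Lemma spike_pair o o' mu nu : 0 <= mu -> 0 <= nu ->
  exists (o'' : option 'I_m) y ga de, [/\ unit_ball y, 0 <= ga, 0 <= de,
    ga + de = mu + nu & mu *: spike o + nu *: spike o' = ga *: y + de *: spike o''].
Proof.
move=> mu0 nu0; have [<-|oo'] := eqVneq o o'.
  exists o, 0, 0, (mu + nu); split; rewrite ?addr_ge0 ?add0r//; first exact: unit_ball0.
  by rewrite scaler0 add0r scalerDl.
have [t /andP[t0 t1] yb] := spike_segment oo'.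
have [le|/ltW le] := leP (nu * (1 - t)) (mu * t).
  have [ga [de [h1 h2 h3 h4]]] :=
    split_at_segment_point (spike o) (spike o') mu0 nu0 t0 le.
  by exists o, ((1 - t) *: spike o + t *: spike o'), ga, de.
have t1' : 0 <= 1 - t by rewrite subr_ge0.
have le' : mu * (1 - (1 - t)) <= nu * (1 - t) by rewrite subKr.
have [ga [de [h1 h2 h3 h4]]] :=
  split_at_segment_point (spike o') (spike o) nu0 mu0 t1' le'.
exists o', ((1 - t) *: spike o + t *: spike o'), ga, de; split=> //.
  by rewrite h3 addrC.
by rewrite addrC h4 subKr (addrC (t *: _)).
Qed.

(** In a combination of two points, [spike_pair] leaves one vertex and a ball point, which is merged
    with the other ball points. *)
Lemma convex_spiky_ball : convex_set spiky_ball.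
Proof.
apply/convex_setP => _ _ l [ o [b [t [hb /andP[t0 t1] ->]]]]
  [ o' [b' [t' [hb' /andP[t0' t1'] ->]]]] /andP[l0 l1].
have l1' : 0 <= 1 - l by rewrite subr_ge0.
have [ o'' [y [ga [de [hy ga0 de0 gade E]]]]] :=
  spike_pair o o' (mulr_ge0 l1' t0) (mulr_ge0 l0 t0').
have al0 : 0 <= (1 - l) * (1 - t) by rewrite mulr_ge0// subr_ge0.
have al0' : 0 <= l * (1 - t') by rewrite mulr_ge0// subr_ge0.
have [c hc Ec] := unit_ball_comb hb hb' hy al0 al0' ga0.
have sum1 : (1 - l) * (1 - t) + l * (1 - t') + ga = 1 - de by lra.
exists o'', c, de; split=> //; first by rewrite de0 -subr_ge0 -sum1 !addr_ge0.
rewrite -sum1 -Ec -addrA -E !scalerDr !scalerA.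
by rewrite -!addrA; congr (_ + _); rewrite addrCA.
Qed.

Lemma closed_hull_sub_spiky_ball :
  closed_convex_hull (@unit_ball R 3 `|` range x) `<=` spiky_ball.
Proof.
apply: smallest_sub.
  by split; [exact: closed_spiky_ball|exact: convex_spiky_ball].
move=> p [pb|[i _ <-]].
  exists None, p, 0; split; rewrite ?lexx ?ler01//.
  by rewrite subr0 scale1r scale0r addr0.
exists (Some i), 0, 1; split; rewrite ?lexx ?ler01//; first exact: unit_ball0.
by rewrite scaler0 add0r scale1r.
Qed.

End spiky_ball.

(** Pythagoras: the displaced point is the foot of the perpendicular from the centre to the line
    through [y] along [z]. *)
Lemma dot3_sub_lt1 y z : dot3 z z = 1 -> dot3 y y - 1 < dot3 z y ^+ 2 ->
  dot3 (y + dot3 z y *: (- z)) (y + dot3 z y *: (- z)) < 1.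
Proof.
move=> zz.
have -> : dot3 (y + dot3 z y *: (- z)) (y + dot3 z y *: (- z)) =
    dot3 y y - 2 * dot3 z y ^+ 2 + dot3 z y ^+ 2 * dot3 z z.
  by rewrite /dot3 !mxE; ring.
by rewrite zz; lra.
Qed.

(** * From vertices and sphere to the whole boundary *)

Section boundary_illumination.
Variables (K : set 'rV[R]_3) (D : set 'rV[R]_3).
Hypotheses (convK : convex_set K) (ballK : @unit_ball R 3 `<=` K).

Lemma interior_open_ball p : dot3 p p < 1 -> interior K p.
Proof.
move=> p1; have : nbhs p [set x : 'rV[R]_3 | dot3 x x < 1].
  exact: open_nbhs_nbhs (conj open_open_ball p1).
by apply: filterS => x x1; apply: ballK; rewrite unit_ballE ltW.
Qed.

(** The homothety of centre [b] and ratio [t] sends the open ball to a neighbourhood inside [K]; [f]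
    is its inverse. *)
Lemma interior_combination b y t : K b -> dot3 y y < 1 -> 0 < t <= 1 ->
  interior K ((1 - t) *: b + t *: y).
Proof.
move=> Kb y1 /andP[t0 t1]; have tn0 : t != 0 by rewrite gt_eqF.
pose f z : 'rV[R]_3 := t^-1 *: (z - (1 - t) *: b).
have fK z : z = (1 - t) *: b + t *: f z.
  by rewrite /f scalerA divff// scale1r addrC subrK.
set z0 := (1 - t) *: b + t *: y.
have fz0 : f z0 = y.
  by rewrite /f /z0 addrC addKr scalerA mulVf// scale1r.
have cf : f @ z0 --> f z0.
  exact: (cvgZ (cvg_cst t^-1) (cvgB cvg_id (cvg_cst ((1 - t) *: b)))).
have : nbhs (f z0) [set x : 'rV[R]_3 | dot3 x x < 1].
  by rewrite fz0; exact: open_nbhs_nbhs (conj open_open_ball y1).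
move=> /cf fn; suff : nbhs z0 K by [].
apply: (@filterS _ (nbhs z0) _ _ _ _ fn) => z /= fz1.
rewrite (fK z); move/convex_setP : convK; apply=> //; last by rewrite t1 ltW.
by apply: ballK; rewrite unit_ballE ltW.
Qed.

Variables (m : nat) (x : 'I_m -> 'rV[R]_3).
Hypothesis Ksub : K `<=` spiky_ball x.
Hypothesis closedK : closed K.
Hypothesis illum_vertex : forall i, exists v ta,
  [/\ D v, 0 <= ta & dot3 (x i + ta *: v) (x i + ta *: v) < 1].
Hypothesis illum_sphere : forall p, dot3 p p = 1 -> exists v ta,
  [/\ D v, 0 <= ta & dot3 (p + ta *: v) (p + ta *: v) < 1].

(** If [v] pushes the vertex [x i] into the open ball, it pushes [(1 - t) *: b + t *: x i] into the
    interior for every [t > 0]. The remaining boundary points lie on the sphere. *)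
Lemma illuminates_of_vertices : illuminates D K.
Proof.
move=> p [/closedK Kp notint].
have ballcase : unit_ball p -> exists2 v, D v & illuminates_point K v p.
  rewrite unit_ballE => p1.
  have pp : dot3 p p = 1.
    apply/eqP; rewrite eq_le p1 leNgt /=; apply/negP => /interior_open_ball.
    exact: notint.
  have [v [ta [Dv ta0 lt1]]] := illum_sphere pp.
  exists v => //; exists (p + ta *: v); split; last exact: interior_open_ball.
  by exists ta => //=; rewrite in_itv/= ta0.
have [ o [b [t [hb /andP[t0 t1] pE]]]] := Ksub Kp.
have [tE|tn0] := eqVneq t 0.
  by apply: ballcase; rewrite pE tE subr0 scale1r scale0r addr0.
have tp : 0 < t by rewrite lt0r tn0.
case: o pE => [i|] /= pE; last first.
  apply: ballcase; rewrite pE; apply: unit_ball_convex => //; last by rewrite t0.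
  exact: unit_ball0.
have [v [ta [Dv ta0 lt1]]] := illum_vertex i.
exists v => //; exists ((1 - t) *: b + t *: (x i + ta *: v)); split.
  exists (t * ta) => /=; first by rewrite in_itv/= andbT mulr_ge0.
  by rewrite pE scalerDr scalerA addrA.
by apply: interior_combination => //; [exact: ballK|rewrite tp].
Qed.

End boundary_illumination.

(** * The tetrahedron of directions and the caps seen from vertices *)

Lemma dot3_tetra_neq (k l : 'I_4) : (k < l)%N -> dot3 (tetra R k) (tetra R l) = - (1 / 3).
Proof.
have := sqrt3V2 R; rewrite expr2; set s := (Num.sqrt 3)^-1 => ss.
case: k l => -[|[|[|[|//]]]] ? [] [|[|[|[|//]]]] ? //= _;
  by rewrite /dot3 /tetra !row3E /= -/s; lra.
Qed.

Lemma inscribed_rotated_tetra q : 0 < normsq q ->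
  inscribed_regular_tetrahedron (range (fun k => - rotation q (tetra R k))).
Proof.
move=> N0; exists (fun k => - rotation q (tetra R k)), (Num.sqrt (8 / 3)).
have unit k : dot3 (rotation q (tetra R k)) (rotation q (tetra R k)) = 1.
  by rewrite rotation_isometry// dot3_tetra.
split=> // [k|k l kl].
- by apply/unit_sphereP; rewrite -scaleN1r dot3Zl dot3Zr unit; ring.
- rewrite enorm_dot3; congr Num.sqrt.
  set y := rotation q (tetra R k); set z := rotation q (tetra R l).
  have -> : dot3 (- y - - z) (- y - - z) = dot3 y y + dot3 z z - 2 * dot3 y z.
    by rewrite /dot3 !mxE; ring.
  by rewrite !unit rotation_isometry// dot3_tetra_neq//; field.
Qed.

(** Here c = cos phi and s = sin phi, with phi the angular radius of the cap of the sphere visible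
    from [y]. *)
Lemma unit_normalize y : 1 < dot3 y y -> exists u r c s,
  [/\ dot3 u u = 1, y = r *: u, 0 < c < 1, 0 <= s
   & [/\ c * r = 1, s ^+ 2 + c ^+ 2 = 1 & 1 < r]].
Proof.
move=> y1; pose r := Num.sqrt (dot3 y y).
have rr : r ^+ 2 = dot3 y y by rewrite sqr_sqrtr// dot3_ge0.
have r1 : 1 < r by rewrite -sqrtr1 ltr_sqrt// (lt_trans _ y1).
have rn0 : r != 0 by rewrite gt_eqF// (lt_trans _ r1).
have c1 : r^-1 < 1 by rewrite invf_lt1// (lt_trans _ r1).
have c0 : 0 < r^-1 by rewrite invr_gt0 (lt_trans _ r1).
have s0 : 0 <= 1 - r^-1 ^+ 2 by rewrite expr2; nra.
exists (r^-1 *: y), r, r^-1, (Num.sqrt (1 - r^-1 ^+ 2)); split.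
- by rewrite dot3Zl dot3Zr -rr; field.
- by rewrite scalerA divff// scale1r.
- by rewrite c0.
- exact: sqrtr_ge0.
- by split; [rewrite mulVf|rewrite sqr_sqrtr// subrK|].
Qed.

(* A common direction of the two caps would have scalar product larger than 1
   with the whole segment joining the vertices. *)
Lemma segment_meets_ball_disjoint_caps x y z :
  segment x y `&` @unit_ball R 3 !=set0 -> dot3 z z = 1 ->
  1 < dot3 z x -> 1 < dot3 z y -> False.
Proof.
move=> [p [[t /=]]]; rewrite in_itv/= => /andP[t0 t1] <-; rewrite unit_ballE => p1.
move=> zz zx zy; have : dot3 z ((1 - t) *: x + t *: y) <= 1.
  by apply: dot3_le1 => //; rewrite zz.
rewrite dot3Dr !dot3Zr; have [->|tn0] := eqVneq t 0; first by lra.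
have : 0 < t * (dot3 z y - 1) by rewrite mulr_gt0 ?subr_gt0// lt0r tn0.
have : 0 <= (1 - t) * (dot3 z x - 1) by rewrite mulr_ge0// subr_ge0// ltW.
lra.
Qed.

End cap_body_geometry.

Theorem mainTheorem2 (R : realType) (K : set 'rV[R]_3) (hK : cap_body K) :
  exists (L : set 'rV[R]_3) (v w : 'rV[R]_3),
    [/\ inscribed_regular_tetrahedron L,
        @unit_sphere R 3 v,
        @unit_sphere R 3 w
      & illuminates (L `|` [set v; w]) K].
Proof.
have [m [x [_ xout meet KE]]] := hK.
have xout1 i : 1 < dot3 (x i) (x i).
  by rewrite ltNge; apply/negP => xi; apply: (xout i); rewrite unit_ballE.
have /choice[u] := fun i => unit_normalize (xout1 i).
move=> /choice[r] /choice[c] /choice[s] H.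
have uu i : dot3 (u i) (u i) = 1 by have [] := H i.
have xE i : x i = r i *: u i by have [] := H i.
have c01 i : 0 < c i < 1 by have [] := H i.
have s0 i : 0 <= s i by have [] := H i.
have cr i : c i * r i = 1 by have [_ _ _ _ []] := H i.
have sc i : s i ^+ 2 + c i ^+ 2 = 1 by have [_ _ _ _ []] := H i.
have r1 i : 1 < r i by have [_ _ _ _ []] := H i.
have disj z i j : dot3 z z = 1 -> c i < dot3 z (u i) -> c j < dot3 z (u j) -> i = j.
  have big k : c k < dot3 z (u k) -> 1 < dot3 z (x k).
    by move=> ck; rewrite xE dot3Zr -(cr k) mulrC ltr_pM2l// (lt_trans _ (r1 k)).
  move=> zz /big ci /big cj; apply/val_inj.
  case: (ltngtP i j) => // ij; exfalso.
    exact: (segment_meets_ball_disjoint_caps (meet _ _ ij) zz ci cj).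
  exact: (segment_meets_ball_disjoint_caps (meet _ _ ij) zz cj ci).
have [q N0] := few_unilluminated_vertices uu s0 c01 sc disj.
set P := [pred i | _] => P2.
pose e := map (fun i => - u i) (enum P).
have se : (size e <= 2)%N by rewrite size_map -cardE.
have d1 : dot3 (axis1 R) (axis1 R) = 1 by exact: dot3_axis1.
(* The default [axis1] supplies unit vectors when fewer than two vertices are missed. *)
pose v := nth (axis1 R) e 0; pose w := nth (axis1 R) e 1.
have unitN (k : nat) : unit_sphere (nth (axis1 R) e k).
  apply/unit_sphereP; have [ke|ke] := ltnP k (size e); last by rewrite nth_default.
  have /mapP[i _ ->] := mem_nth (axis1 R) ke.
  by rewrite -scaleN1r dot3Zl dot3Zr uu; ring.
pose L := range (fun k => - rotation q (tetra R k)).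
exists L, v, w; split; [exact: inscribed_rotated_tetra|exact: unitN|exact: unitN|].
have gens : @unit_ball R 3 `|` range x `<=` K by rewrite KE; exact: sub_gen_smallest.
have closedK : closed K.
  by rewrite KE /closed_convex_hull /smallest; apply: closed_bigI => C [[]].
have convK : convex_set K.
  apply/convex_setP => y z t; rewrite KE /closed_convex_hull /smallest => Ky Kz t01 A HA.
  have [[_ /convex_setP cvA] _] := HA.
  exact: cvA (Ky A HA) (Kz A HA) t01.
have tetra_unit k : dot3 (rotation q (tetra R k)) (rotation q (tetra R k)) = 1.
  by rewrite rotation_isometry// dot3_tetra.
have tetra_in k : (L `|` [set v; w]) (- rotation q (tetra R k)) by left; exists k.
apply: (@illuminates_of_vertices _ _ _ convK _ _ x) => //.
- by move=> p pb; apply: gens; left.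
- by rewrite KE; exact: closed_hull_sub_spiky_ball.
- move=> i; have [iP|iP] := boolP (i \in P); last first.
    move: iP; rewrite unfold_in /= => /asboolPn /existsNP[k /negP].
    rewrite -ltNge => ltk.
    have sk : s i < dot3 (rotation q (tetra R k)) (u i).
      by rewrite dot3_rotation ltr_pdivlMr.
    have rp : 0 < r i by rewrite (lt_trans _ (r1 i)).
    have xk : dot3 (rotation q (tetra R k)) (x i) =
        r i * dot3 (rotation q (tetra R k)) (u i) by rewrite xE dot3Zr.
    exists (- rotation q (tetra R k)), (dot3 (rotation q (tetra R k)) (x i)); split; first exact: tetra_in.
      by rewrite xk mulr_ge0 ?ltW// (le_lt_trans (s0 i)).
    apply: dot3_sub_lt1 => //.
    have -> : dot3 (x i) (x i) - 1 = (r i * s i) ^+ 2.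
      rewrite xE dot3Zl dot3Zr uu exprMn.
      have -> : s i ^+ 2 = 1 - c i ^+ 2 by rewrite -(sc i) addrK.
      have : (c i * r i) ^+ 2 = 1 by rewrite cr expr1n.
      by rewrite exprMn => E; rewrite mulrBr mulr1 -{1}E; ring.
    have rs0 : 0 <= r i * s i by rewrite mulr_ge0// ltW.
    have rsk : r i * s i < r i * dot3 (rotation q (tetra R k)) (u i) by rewrite ltr_pM2l.
    by rewrite xk ltr_pXn2r// nnegrE (le_trans rs0)// ltW.
  have ie : - u i \in e by apply/mapP; exists i => //; rewrite mem_enum.
  (* A missed vertex is sent straight to the centre of the ball. *)
  exists (- u i), (r i); split.
  + have i2 : (index (- u i) e < 2)%N by rewrite (leq_trans _ se)// index_mem.
    right; rewrite -(nth_index (axis1 R) ie).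
    case: (index (- u i) e) i2 => [|[|n]] i2; last by [].
      by left.
    by right.
  + by rewrite ltW// (lt_trans _ (r1 i)).
  + by rewrite xE scalerN subrr /dot3 !mxE !mulr0 !addr0 ltr01.
- move=> p pp; have ta := rotation_tetra_values N0 pp.
  (* Some vertex of the rotated tetrahedron has a positive scalar product with [p], otherwise the
     bound 1/3 would fail; its opposite enters the open ball from [p]. *)
  have [k pk] : exists k, 0 < rotdot q (tetra R k) p / normsq q.
    apply: contrapT => none; suff : 1 / 3 <= 0 :> R by lra.
    apply: (some_tetra_value_ge ta) => k; rewrite leNgt; apply/negP => pk.
    by apply: none; exists k.
  rewrite -dot3_rotation in pk.
  exists (- rotation q (tetra R k)), (dot3 (rotation q (tetra R k)) p); split; first exact: tetra_in.
    exact: ltW.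
  by apply: dot3_sub_lt1 => //; rewrite pp subrr exprn_gt0.
Qed.
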